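(* Let $n$ and $m$ be integers with $n \le m < 2(n-2)$. Let $G^\sigma$ be an oriented graph with minimal skew energy among all connected oriented graphs with $n$ vertices and $m$ arcs. Then, up to isomorphism, $G^\sigma$ is (1) $O^+_{n,m}$ if $m < \frac{3n-5}{2}$; (2) either $B^+_{n,m}$ or $O^+_{n,m}$ if $m = \frac{3n-5}{2}$; (3) $B^+_{n,m}$ otherwise.
   Context: An oriented graph $G^\sigma$ is a simple undirected graph $G$ (its underlying graph) together with an orientation $\sigma$ assigning a direction to each edge; $(u,v)$ denotes an arc with tail $u$ and head $v$. For vertex set $\{v_1,\dots,v_n\}$, the skew-adjacency matrix $S(G^\sigma)=[s_{ij}]$ has $s_{ij}=1$ if $(v_i,v_j)$ is an arc, $s_{ij}=-1$ if $(v_j,v_i)$ is an arc, and $s_{ij}=0$ otherwise. The skew energy $\mathcal{E}_S(G^\sigma)$ is the sum of the singular values of $S(G^\sigma)$ (equivalently, the sum of the absolute values of its eigenvalues). $O^+_{n,m}$ is the oriented graph on vertices $v_1,\dots,v_n$ with arcs $(v_1,v_j)$ for $j=2,\dots,n$ and arcs $(v_j,v_2)$ for $j=3,\dots,m-n+3$ (so it is an oriented star centered at $v_1$ plus $m-n+1$ arcs sharing the common vertex $v_2$, with $v_1$ the tail of every arc incident to it and $v_2$ the head of every arc incident to it). $B^+_{n,m}$ is the oriented graph obtained from $O^+_{n,m+1}$ by deleting the arc $(v_1,v_2)$; i.e., its arcs are $(v_1,v_j)$ for $j=3,\dots,n$ and $(v_j,v_2)$ for $j=3,\dots,m-n+4$.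 Both have $n$ vertices and $m$ arcs.
   Formalization: ''Up to isomorphism'' is taken to mean up to isomorphism, switching (reversing all arcs between a vertex set and its complement) and reversal of all arcs; with plain isomorphism the claim fails, since reversing a pendant arc keeps the skew energy but changes the isomorphism class. *)

(* Defs.v *)
From mathcomp Require Import all_boot all_order all_algebra.
From mathcomp Require Import all_fingroup zify.
Set Implicit Arguments.
Unset Strict Implicit.
Unset Printing Implicit Defensive.
Import Order.TTheory GRing.Theory Num.Theory.
Local Open Scope ring_scope.
Local Open Scope sesquilinear_scope.

(* An oriented graph with vertices v_1, ..., v_n; v_k is the ordinal k - 1.
   Asymmetry excludes both loops and pairs of opposite arcs, so the underlying
   graph is simple and each of its edges has exactly one direction. *)
Record orgraph (n : nat) := OrGraph {
  arc :> rel 'I_n;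
  arc_asym : forall i j, arc i j -> ~~ arc j i }.

Definition num_arcs n (G : orgraph n) : nat :=
  #|[set p : 'I_n * 'I_n | G p.1 p.2]|.

Definition edge n (G : orgraph n) : rel 'I_n := [rel i j | G i j || G j i].

Definition connected n (G : orgraph n) : Prop :=
  forall i j : 'I_n, connect (edge G) i j.

Definition skew_adj (R : pzRingType) n (G : orgraph n) : 'M[R]_n :=
  \matrix_(i, j) (if G i j then 1 else if G j i then -1 else 0).

(* The roots of the characteristic polynomial, with multiplicity. *)
Definition eigenvalues (C : numClosedFieldType) n (A : 'M[C]_n) : seq C :=
  sval (closed_field_poly_normal (char_poly A)).

Definition singular_values (C : numClosedFieldType) n (A : 'M[C]_n) : seq C :=
  [seq sqrtC x | x <- eigenvalues (A ^t* *m A)].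

Definition skew_energy (C : numClosedFieldType) n (G : orgraph n) : C :=
  \sum_(s <- singular_values (skew_adj C G)) s.

(* The order of C is only partial, but skew energies are nonnegative reals. *)
Definition min_skew_energy (C : numClosedFieldType) n m (G : orgraph n) : Prop :=
  [/\ connected G, num_arcs G = m
    & forall H : orgraph n, connected H -> num_arcs H = m ->
        skew_energy C G <= skew_energy C H].

Definition Oplus_arc n m : rel 'I_n := fun i j =>
  ((i == 0 :> nat) && (0 < j) || (1 < i < m - n + 3) && (j == 1 :> nat))%N.

Lemma Oplus_asym n m i j : @Oplus_arc n m i j -> ~~ Oplus_arc m j i.
Proof. by rewrite /Oplus_arc; lia. Qed.

(* Arcs (v_1, v_j) for 2 <= j <= n and (v_j, v_2) for 3 <= j <= m - n + 3. *)
Definition Oplus n m : orgraph n := OrGraph (@Oplus_asym n m).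

Definition Bplus_arc n m : rel 'I_n := fun i j =>
  Oplus n m.+1 i j && ~~ ((i == 0 :> nat) && (j == 1 :> nat))%N.

Lemma Bplus_asym n m i j : @Bplus_arc n m i j -> ~~ Bplus_arc m j i.
Proof. by rewrite /Bplus_arc => /andP[/arc_asym nji _]; rewrite negb_and nji. Qed.

Definition Bplus n m : orgraph n := OrGraph (@Bplus_asym n m).

Definition isomorphic n (G H : orgraph n) : Prop :=
  exists f : {perm 'I_n}, forall i j, H (f i) (f j) = G i j.

Definition switch_arc n (W : {set 'I_n}) (G : orgraph n) : rel 'I_n :=
  fun i j => if (i \in W) == (j \in W) then G i j else G j i.

Lemma switch_asym n (W : {set 'I_n}) (G : orgraph n) i j :
  switch_arc W G i j -> ~~ switch_arc W G j i.
Proof. by rewrite /switch_arc eq_sym; case: ifP => _; apply: arc_asym. Qed.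

(* Switching with respect to W: reverse the arcs between W and its complement.
   This replaces S(G) by D S(G) D with D diagonal with entries +1 and -1. *)
Definition switch n (W : {set 'I_n}) (G : orgraph n) : orgraph n :=
  OrGraph (@switch_asym n W G).

Lemma converse_asym n (G : orgraph n) i j : G j i -> ~~ G i j.
Proof. exact: arc_asym. Qed.

(* Reversing all arcs replaces S(G) by - S(G). *)
Definition converse n (G : orgraph n) : orgraph n :=
  OrGraph (arc := fun i j => G j i) (@converse_asym n G).

(* Isomorphism of oriented graphs up to switching and global reversal: both
   operations leave the singular values of S(G) unchanged, but neither
   preserves the plain isomorphism class, so minimal skew energy can only
   determine an oriented graph up to this relation. For instance, reversing
   the arc at a pendant vertex is a switching; and O^+_{8,9} is not related to
   its converse by switchings and isomorphisms alone, as these preserve the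
   common sign of s_12 s_2j s_j1 on its two triangles. *)
Definition skew_isomorphic n (G H : orgraph n) : Prop :=
  exists W : {set 'I_n},
    isomorphic (switch W G) H \/ isomorphic (switch W (converse G)) H.

(* Main.v *)
(* Let S be the skew-adjacency matrix of G and let x_1, ..., x_r be the positive
   eigenvalues of iS, so that the skew energy is 2 (x_1 + ... + x_r) and
   x_1^2 + ... + x_r^2 = m.  With a_4 the second elementary symmetric function
   of the x_i^2, one has (x_1 + ... + x_r)^2 >= m + 2 sqrt(a_4), with equality
   when r <= 2, which holds for O^+ and B^+ as every arc meets v_1 or v_2.
   Hence a_4(G) <= a_4(O^+), a_4(B^+), and it remains to minimise a_4, the sum
   of the squared Pfaffians of S over the 4-sets of vertices.

   Put k = m - n + 1 and f(k) = k (n - 2 - k); then a_4(O^+) = f(k) and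
   a_4(B^+) = f(k + 1).  If a vertex has degree n - 1 then a_4 >= f(k), and if
   one has degree n - 2 then a_4 >= f(k + 1); equality forces all edges to meet
   one of two hubs.  In the remaining case, a_4 exceeds the minimum of f(k) and
   f(k + 1), by induction on n: a vertex w of minimum degree has degree at most
   3; if it is a cut vertex then G is glued from G_1 and G_2 at w and
   a_4(G) = a_4(G_1) + a_4(G_2) + m_1 m_2 - d_1(w) d_2(w); otherwise one deletes
   w and counts the 4-sets through w whose Pfaffian is odd. *)

Require Import Defs.
From mathcomp Require Import all_boot all_order all_algebra.
From mathcomp Require Import all_fingroup zify ring lra.
Set Implicit Arguments.
Unset Strict Implicit.
Unset Printing Implicit Defensive.

(** * Sums of symmetric functions *)

Section SymmetricSums.
Import GRing.Theory.
Local Open Scope ring_scope.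
Variables (T : finType).
Implicit Types (A B C D : {set T}).

Lemma sum_setU A B (F : T -> int) : [disjoint A & B] ->
  \sum_(x in A :|: B) F x = \sum_(x in A) F x + \sum_(x in B) F x.
Proof.
move=> dAB; rewrite -bigU //=.
by apply: eq_bigl => x; rewrite !inE.
Qed.

Lemma sum_const A (c : int) : \sum_(x in A) c = #|A|%:Z * c.
Proof. by rewrite sumr_const -mulr_natl natz. Qed.

Definition sum3 A B C (g : T -> T -> T -> int) :=
  \sum_(x in A) \sum_(y in B) \sum_(z in C) g x y z.

Lemma sum3_swap12 A B C g : (forall x y z, g x y z = g y x z) ->
  sum3 A B C g = sum3 B A C g.
Proof.
move=> gC; rewrite /sum3 exchange_big; apply: eq_bigr => x _; apply: eq_bigr => y _.
by apply: eq_bigr => z _; rewrite gC.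
Qed.

Lemma sum3_swap23 A B C g : (forall x y z, g x y z = g x z y) ->
  sum3 A B C g = sum3 A C B g.
Proof.
move=> gC; rewrite /sum3; apply: eq_bigr => x _; rewrite exchange_big.
by apply: eq_bigr => y _; apply: eq_bigr => z _; rewrite gC.
Qed.

Lemma sum3D A B C g h :
  sum3 A B C (fun x y z => g x y z + h x y z) = sum3 A B C g + sum3 A B C h.
Proof.
rewrite /sum3 -big_split; apply: eq_bigr => x _; rewrite -big_split.
by apply: eq_bigr => y _; rewrite -big_split.
Qed.

Lemma sum3Z A B C c g : sum3 A B C (fun x y z => c * g x y z) = c * sum3 A B C g.
Proof.
rewrite /sum3 mulr_sumr; apply: eq_bigr => x _; rewrite mulr_sumr.
by apply: eq_bigr => y _; rewrite mulr_sumr.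
Qed.

Lemma sum3_setU A B g : [disjoint A & B] ->
  (forall x y z, g x y z = g y x z) -> (forall x y z, g x y z = g x z y) ->
  sum3 (A :|: B) (A :|: B) (A :|: B) g =
  sum3 A A A g + sum3 B B B g + 3 * sum3 A A B g + 3 * sum3 A B B g.
Proof.
move=> dAB g12 g23.
have E C D : sum3 (A :|: B) C D g = sum3 A C D g + sum3 B C D g.
  by rewrite /sum3 sum_setU.
rewrite E !(sum3_swap12 _ (A :|: B)) // !E.
rewrite !(sum3_swap23 _ _ (A :|: B)) // !(sum3_swap12 _ (A :|: B)) // !E.
rewrite (sum3_swap12 B A A) // (sum3_swap23 A B A) // (sum3_swap12 B A B) //.
rewrite (sum3_swap23 B B A) // (sum3_swap12 B A B) //; ring.
Qed.

Definition sum4 A B C D (g : T -> T -> T -> T -> int) :=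
  \sum_(x in A) sum3 B C D (g x).

(** Expanding every slot gives the binomial pattern 1, 4, 6, 4, 1: the three adjacent transpositions
    generate all permutations, so terms with equally many slots in A coincide. *)
Lemma sum4_setU A B g : [disjoint A & B] ->
  (forall x y z t, g x y z t = g y x z t) ->
  (forall x y z t, g x y z t = g x z y t) ->
  (forall x y z t, g x y z t = g x y t z) ->
  sum4 (A :|: B) (A :|: B) (A :|: B) (A :|: B) g =
  sum4 A A A A g + sum4 B B B B g + 4 * sum4 A A A B g + 4 * sum4 A B B B g
  + 6 * sum4 A A B B g.
Proof.
move=> dAB g12 g23 g34.
have s12 A1 A2 A3 A4 : sum4 A1 A2 A3 A4 g = sum4 A2 A1 A3 A4 g.
  rewrite /sum4 /sum3 exchange_big; apply: eq_bigr => x _; apply: eq_bigr => y _.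
  by apply: eq_bigr => z _; apply: eq_bigr => t _.
have s23 A1 A2 A3 A4 : sum4 A1 A2 A3 A4 g = sum4 A1 A3 A2 A4 g.
  by apply: eq_bigr => x _; apply: sum3_swap12 => y z t.
have s34 A1 A2 A3 A4 : sum4 A1 A2 A3 A4 g = sum4 A1 A2 A4 A3 g.
  by apply: eq_bigr => x _; apply: sum3_swap23 => y z t.
have E C : sum4 C (A :|: B) (A :|: B) (A :|: B) g =
    sum4 C A A A g + sum4 C B B B g + 3 * sum4 C A A B g + 3 * sum4 C A B B g.
  rewrite /sum4 !mulr_sumr -!big_split /=; apply: eq_bigr => x _.
  by rewrite sum3_setU.
rewrite {1}/sum4 sum_setU // -/(sum4 A _ _ _ _) -/(sum4 B _ _ _ _) !E.
rewrite (s12 B A A A) (s23 A B A A) (s34 A A B A).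
rewrite (s12 B A A B) (s23 A B A B) (s12 B A B B).
ring.
Qed.

End SymmetricSums.

(** * Sums of squared Pfaffians *)

Section SkewFunction.
Import Order.TTheory GRing.Theory Num.Theory.
Local Open Scope ring_scope.
Variables (T : finType) (s : T -> T -> int).
Implicit Types (A B R U X : {set T}).

Definition skew_fun :=
  (forall x y, s x y = - s y x) /\
  (forall x y, [|| s x y == 0, s x y == 1 | s x y == -1]).

Hypothesis s_skew : skew_fun.
Let sN : forall x y, s x y = - s y x := s_skew.1.
Let sV : forall x y, [|| s x y == 0, s x y == 1 | s x y == -1] := s_skew.2.

Definition adj x y := s x y ^+ 2.
Definition deg A x := \sum_(y in A) adj x y.
Definition dbl_edges A := \sum_(x in A) deg A x.
(** The determinant of the 4 by 4 principal submatrix on x, y, z, t. It is symmetric and vanishes on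
    repeated indices, so sums over ordered tuples can replace sums over sets. *)
Definition pf2 x y z t := (s x y * s z t - s x z * s y t + s x t * s y z) ^+ 2.
(* Over ordered quadruples, hence 24 times the sum over 4-sets. *)
Definition pf_sum4 A := sum4 A A A A pf2.
Definition pf_sum3 w A := sum3 A A A (pf2 w).

Lemma adjC x y : adj x y = adj y x.
Proof. by rewrite /adj sN sqrrN. Qed.

Lemma skew_xx x : s x x = 0.
Proof. by have := sN x x; lia. Qed.

Lemma adj_xx x : adj x x = 0.
Proof. by rewrite /adj skew_xx expr0n. Qed.

Variant adj_spec x y : int -> int -> Prop :=
  | Adj0 of s x y = 0 : adj_spec x y 0 0
  | AdjP of s x y = 1 : adj_spec x y 1 1
  | AdjN of s x y = -1 : adj_spec x y (-1) 1.

Lemma adjP x y : adj_spec x y (s x y) (adj x y).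
Proof.
rewrite /adj; case/or3P: (sV x y) => /eqP E; rewrite E ?sqrrN ?expr1n ?expr0n;
  by constructor.
Qed.

Lemma adj01 x y : adj x y = 0 \/ adj x y = 1.
Proof. by case: adjP; auto. Qed.

Lemma adj_ge0 x y : 0 <= adj x y.
Proof. exact: sqr_ge0. Qed.

Lemma adj_eq0 x y : adj x y = 0 -> s x y = 0.
Proof. by case: adjP. Qed.

Lemma pf2C12 x y z t : pf2 x y z t = pf2 y x z t.
Proof. rewrite /pf2 (sN y x); ring. Qed.

Lemma pf2C23 x y z t : pf2 x y z t = pf2 x z y t.
Proof. rewrite /pf2 (sN z y); ring. Qed.

Lemma pf2C34 x y z t : pf2 x y z t = pf2 x y t z.
Proof. rewrite /pf2 (sN t z); ring. Qed.

Lemma pf2_xx x z t : pf2 x x z t = 0.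
Proof. by rewrite /pf2 skew_xx; ring. Qed.

Lemma pf2_ge0 x y z t : 0 <= pf2 x y z t.
Proof. exact: sqr_ge0. Qed.

Lemma deg_ge0 A x : 0 <= deg A x.
Proof. by apply: sumr_ge0 => y _; apply: adj_ge0. Qed.

Lemma dbl_edges_ge0 A : 0 <= dbl_edges A.
Proof. by apply: sumr_ge0 => y _; apply: deg_ge0. Qed.

Lemma pf_sum3_ge0 w A : 0 <= pf_sum3 w A.
Proof. by do 3![apply: sumr_ge0 => ? _]; apply: pf2_ge0. Qed.

Lemma pf_sum4_ge0 A : 0 <= pf_sum4 A.
Proof. by apply: sumr_ge0 => ? _; apply: pf_sum3_ge0. Qed.

Lemma deg_setU A B x : [disjoint A & B] -> deg (A :|: B) x = deg A x + deg B x.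
Proof. exact: sum_setU. Qed.

Lemma deg_set1 x y : deg [set y] x = adj x y.
Proof. by rewrite /deg big_set1. Qed.

Lemma sum_dgC A B : \sum_(x in A) deg B x = \sum_(y in B) deg A y.
Proof.
rewrite /deg exchange_big /=; apply: eq_bigr => x _; apply: eq_bigr => y _.
exact: adjC.
Qed.

Lemma dbl_edges_setU A B : [disjoint A & B] ->
  dbl_edges (A :|: B) = dbl_edges A + dbl_edges B + 2 * \sum_(x in A) deg B x.
Proof.
move=> dAB; rewrite /dbl_edges sum_setU //.
under eq_bigr do rewrite deg_setU //; rewrite big_split /=.
under [X in _ + X = _]eq_bigr do rewrite deg_setU //.
rewrite big_split /= (sum_dgC B A); ring.
Qed.

Lemma disjoint1U w A : w \notin A -> [disjoint A & [set w]].
Proof. by move=> wA; rewrite disjoint_sym disjoints1. Qed.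

Lemma dbl_edges_set1 x : dbl_edges [set x] = 0.
Proof. by rewrite /dbl_edges big_set1 deg_set1 adj_xx. Qed.

Lemma deg_setU1 w A x : w \notin A -> deg (w |: A) x = adj x w + deg A x.
Proof. by move=> wA; rewrite setUC deg_setU ?disjoint1U // deg_set1 addrC. Qed.

Lemma dbl_edges_setU1 w A : w \notin A -> dbl_edges (w |: A) = dbl_edges A + 2 * deg A w.
Proof.
move=> wA; rewrite setUC dbl_edges_setU ?disjoint1U // dbl_edges_set1 sum_dgC big_set1; ring.
Qed.

(** The new quadruples have w in exactly one of the four slots, since a Pfaffian with w repeated
    vanishes. *)
Lemma pf_sum4_setU1 w A : w \notin A -> pf_sum4 (w |: A) = pf_sum4 A + 4 * pf_sum3 w A.
Proof.
move=> wA; rewrite /pf_sum4 setUC (sum4_setU (disjoint1U wA) pf2C12 pf2C23 pf2C34).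
have z34 x y : pf2 x y w w = 0.
  by rewrite pf2C23 pf2C34 pf2C12 pf2C23 pf2_xx.
rewrite /sum4 /sum3 !(big_set1, pf2_xx, mulr0, addr0).
rewrite [X in _ + 4 * X]big1 ?mulr0 ?addr0; last by move=> x _; rewrite !big_set1 z34.
rewrite [X in 6 * X]big1 ?mulr0 ?addr0; last first.
  by move=> x _; apply: big1 => y _; rewrite !big_set1 z34.
congr (_ + 4 * _); rewrite /pf_sum3 /sum3.
apply: eq_bigr => x _; apply: eq_bigr => y _; apply: eq_bigr => z _.
by rewrite big_set1 pf2C34 pf2C23 pf2C12.
Qed.

Lemma pf_sum3_setU w A B : [disjoint A & B] ->
  pf_sum3 w (A :|: B) =
  pf_sum3 w A + pf_sum3 w B + 3 * sum3 A A B (pf2 w) + 3 * sum3 A B B (pf2 w).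
Proof.
by move=> dAB; apply: sum3_setU => // *; [apply: pf2C23 | apply: pf2C34].
Qed.

(* Each 4-set {w, u, v, z} with u, v adjacent to w and z not has Pfaffian
   [s w u * s v z - s w v * s u z], which is odd iff z sees exactly one of u, v. *)
Lemma pf_sum3_star_lb w U R : [disjoint U & R] ->
  {in U, forall u, adj w u = 1} -> {in R, forall z, adj w z = 0} ->
  pf_sum3 w U + 6 * \sum_(z in R) deg U z * (#|U|%:Z - deg U z) + 3 * #|U|%:Z * dbl_edges R
  <= pf_sum3 w (U :|: R).
Proof.
move=> dUR wU wR; rewrite pf_sum3_setU //.
have sR z : z \in R -> s w z = 0 by move=> /wR /adj_eq0.
have -> : sum3 U R R (pf2 w) = #|U|%:Z * dbl_edges R.
  rewrite /sum3 (eq_bigr (fun=> dbl_edges R)); first by rewrite sum_const.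
  move=> u uU; apply: eq_bigr => y yR; apply: eq_bigr => z zR.
  by rewrite /pf2 (sR y yR) (sR z zR) !mul0r subr0 addr0 exprMn -/(adj w u) wU // mul1r.
have H : 2 * \sum_(z in R) deg U z * (#|U|%:Z - deg U z) <= sum3 U U R (pf2 w).
  have -> : sum3 U U R (pf2 w) = sum3 R U U (fun z u v => pf2 w u v z).
    rewrite /sum3 exchange_big /=; under eq_bigr do rewrite exchange_big /=.
    by rewrite exchange_big; apply: eq_bigr => z _; rewrite exchange_big.
  rewrite mulr_sumr; apply: ler_sum => z zR.
  (* A squared difference of 0/1 values marks the ordered pairs u, v of which z sees exactly one;
     for these the Pfaffian is odd, so its square is at least 1. *)
  have -> : 2 * (deg U z * (#|U|%:Z - deg U z)) =
      \sum_(u in U) \sum_(v in U) (adj z u - adj z v) ^+ 2.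
    have E u v : (adj z u - adj z v) ^+ 2 = adj z u + adj z v - 2 * (adj z u * adj z v).
      by case: (adj01 z u) => ->; case: (adj01 z v) => ->.
    under eq_bigr do under eq_bigr do rewrite E.
    under eq_bigr do rewrite sumrB big_split /= sum_const -[X in _ - X]mulr_sumr -mulr_sumr.
    rewrite sumrB big_split /= -!mulr_sumr -mulr_suml sum_const -!/(deg U z); ring.
  apply: ler_sum => u uU; apply: ler_sum => v vU.
  rewrite /pf2 (sR z) // mul0r addr0 (sN v z) (sN u z).
  have := wU u uU; have := wU v vU.
  by case: (adjP w v) => // _ _; case: (adjP w u) => // _ _;
    case: (adjP z u) => _; case: (adjP z v) => _.
have := pf_sum3_ge0 w R; lia.
Qed.

(** * Edges and triangles inside a neighbourhood *)

Definition tri A := sum3 A A A (fun x y z => adj x y * adj y z * adj x z).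

Lemma tri_ge0 A : 0 <= tri A.
Proof. do 3![apply: sumr_ge0 => ? _].
by apply: mulr_ge0; rewrite ?adj_ge0 //; apply: mulr_ge0; apply: adj_ge0. Qed.

Lemma edge_deg A x y : x \in A -> y \in A -> adj x y = 1 ->
  dbl_edges A + 2 = dbl_edges (A :\ x :\ y) + 2 * deg A x + 2 * deg A y.
Proof.
move=> xA yA exy.
have nxy : y != x by apply: contra_eqN exy => /eqP ->; rewrite adj_xx.
have yAx : y \in A :\ x by rewrite !inE nxy.
have nD (z : T) (B : {set T}) : z \notin B :\ z by rewrite setD11.
have eqA := setD1K xA; have eqAx := setD1K yAx.
have := dbl_edges_setU1 (nD x A); rewrite eqA => ->.
have := dbl_edges_setU1 (nD y (A :\ x)); rewrite eqAx => ->.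
have dA z := deg_setU1 z (nD x A); rewrite eqA in dA.
have dAx z := deg_setU1 z (nD y (A :\ x)); rewrite eqAx in dAx.
rewrite !dA !dAx !adj_xx (adjC y x) exy; ring.
Qed.

(* The edges disjoint from an edge xy number e(A) + 1 - deg x - deg y. *)
Lemma sum_sqr_deg A : 4 * \sum_(x in A) deg A x ^+ 2 =
  dbl_edges A ^+ 2 + 2 * dbl_edges A -
  \sum_(x in A) \sum_(y in A) adj x y * dbl_edges (A :\ x :\ y).
Proof.
have -> : \sum_(x in A) \sum_(y in A) adj x y * dbl_edges (A :\ x :\ y) =
  \sum_(x in A) \sum_(y in A) adj x y * (dbl_edges A + 2 - 2 * deg A x - 2 * deg A y).
  apply: eq_bigr => x xA; apply: eq_bigr => y yA.
  case: (adj01 x y) => exy; rewrite exy ?mul0r // !mul1r.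
  by have := edge_deg xA yA exy; lia.
have E1 : \sum_(x in A) \sum_(y in A) adj x y * deg A x = \sum_(x in A) deg A x ^+ 2.
  by apply: eq_bigr => x _; rewrite -mulr_suml.
have E3 : \sum_(x in A) \sum_(y in A) adj x y * deg A y = \sum_(x in A) deg A x ^+ 2.
  rewrite -E1 exchange_big /=; apply: eq_bigr => x _; apply: eq_bigr => y _.
  by rewrite adjC.
have -> : \sum_(x in A) \sum_(y in A) adj x y * (dbl_edges A + 2 - 2 * deg A x - 2 * deg A y)
  = \sum_(x in A) \sum_(y in A) (adj x y * (dbl_edges A + 2) + (-2) * (adj x y * deg A x)
    + (-2) * (adj x y * deg A y)).
  by apply: eq_bigr => x _; apply: eq_bigr => y _; ring.
under [X in _ - X]eq_bigr do rewrite !big_split /= -mulr_suml -!mulr_sumr.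
by rewrite !big_split /= -mulr_suml -!mulr_sumr E1 E3 -/(dbl_edges A); ring.
Qed.

(* The parity of the number of edges among x, y, z, as a polynomial. *)
Definition odd3 x y z :=
  adj x y + adj y z + adj x z
  - 2 * (adj x y * adj y z + adj y z * adj x z + adj x y * adj x z)
  + 4 * (adj x y * adj y z * adj x z).

(** When w sees x, y and z, the Pfaffian is a signed sum of the three entries among them, so it has
    the parity of their number of edges; an odd square is at least 1. *)
Lemma pf2_odd3 w x y z : adj w x = 1 -> adj w y = 1 -> adj w z = 1 ->
  odd3 x y z <= pf2 w x y z.
Proof.
rewrite /odd3 /pf2.
case: (adjP w x) => // _ _; case: (adjP w y) => // _ _; case: (adjP w z) => // _ _;
case: (adjP x y) => // _; case: (adjP y z) => // _; case: (adjP x z) => // _.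
Qed.

(** The monomials of [odd3] count edges, paths of length two and triangles. Trading squared degrees
    for pairs of disjoint edges makes the excess terms nonnegative, which the equality case
    exploits. *)
Lemma sum_odd3 A : 2 * sum3 A A A odd3 =
  6 * #|A|%:Z * dbl_edges A - 3 * dbl_edges A ^+ 2 - 6 * dbl_edges A
  + 3 * (\sum_(x in A) \sum_(y in A) adj x y * dbl_edges (A :\ x :\ y)) + 8 * tri A.
Proof.
have H : sum3 A A A odd3 = 3 * #|A|%:Z * dbl_edges A - 6 * \sum_(x in A) deg A x ^+ 2 + 4 * tri A.
  have S1 : sum3 A A A (fun x y z => adj x y) = #|A|%:Z * dbl_edges A.
    rewrite /sum3 [RHS]mulr_sumr; apply: eq_bigr => x _; rewrite [RHS]mulr_sumr.
    by apply: eq_bigr => y _; rewrite sum_const.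
  have S2 : sum3 A A A (fun x y z => adj y z) = #|A|%:Z * dbl_edges A.
    by rewrite /sum3 sum_const.
  have S3 : sum3 A A A (fun x y z => adj x z) = #|A|%:Z * dbl_edges A.
    rewrite /sum3 [RHS]mulr_sumr; apply: eq_bigr => x _.
    by rewrite sum_const.
  have S4 : sum3 A A A (fun x y z => adj x y * adj x z) = \sum_(x in A) deg A x ^+ 2.
    rewrite /sum3; apply: eq_bigr => x _.
    by under eq_bigr do rewrite -mulr_sumr; rewrite -mulr_suml.
  have S5 : sum3 A A A (fun x y z => adj x y * adj y z) = \sum_(x in A) deg A x ^+ 2.
    rewrite -S4 /sum3 exchange_big; apply: eq_bigr => x _; apply: eq_bigr => y _.
    by apply: eq_bigr => z _; rewrite (adjC x y).
  have S6 : sum3 A A A (fun x y z => adj y z * adj x z) = \sum_(x in A) deg A x ^+ 2.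
    rewrite -S5 /sum3; apply: eq_bigr => x _; rewrite exchange_big.
    apply: eq_bigr => y _; apply: eq_bigr => z _; rewrite (adjC z y); ring.
  transitivity (sum3 A A A (fun x y z => adj x y + (adj y z + (adj x z
    + (-2 * (adj x y * adj y z) + (-2 * (adj y z * adj x z)
    + (-2 * (adj x y * adj x z) + 4 * (adj x y * adj y z * adj x z)))))))).
    by do 3![apply: eq_bigr => ? _]; rewrite /odd3; ring.
  by rewrite !sum3D !sum3Z S1 S2 S3 S4 S5 S6 /tri; ring.
rewrite H; have := sum_sqr_deg A; lia.
Qed.

Lemma pf_sum3_nbr_lb w A : {in A, forall u, adj w u = 1} ->
  6 * #|A|%:Z * dbl_edges A - 3 * dbl_edges A ^+ 2 - 6 * dbl_edges A
  + 3 * (\sum_(x in A) \sum_(y in A) adj x y * dbl_edges (A :\ x :\ y)) + 8 * tri A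
  <= 2 * pf_sum3 w A.
Proof.
move=> wA; rewrite -sum_odd3 ler_pM2l //.
do 3![apply: ler_sum => ? ?]; apply: pf2_odd3; exact: wA.
Qed.

End SkewFunction.

(** * Disjoint unions, connectivity and stars *)

Section LowerBound.
Import Order.TTheory GRing.Theory Num.Theory.
Local Open Scope ring_scope.
Variables (T : finType) (s : T -> T -> int).
Hypothesis s_skew : skew_fun s.
Implicit Types (A B D R U X : {set T}).

Local Notation adj := (adj s).
Local Notation deg := (deg s).
Local Notation dbl_edges := (dbl_edges s).
Local Notation pf_sum3 := (pf_sum3 s).
Local Notation pf_sum4 := (pf_sum4 s).

(** A perfect matching of four vertices uses no edge between A and B, so each side holds 0, 2 or 4
    of them; 6 counts the choices of two slots for A. *)
Lemma pf_sum4_setU A B : [disjoint A & B] ->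
  {in A & B, forall x y, adj x y = 0} ->
  pf_sum4 (A :|: B) = pf_sum4 A + pf_sum4 B + 6 * (dbl_edges A * dbl_edges B).
Proof.
move=> dAB nAB.
have s0 x y : x \in A -> y \in B -> s x y = 0.
  by move=> xA yB; apply: adj_eq0 => //; apply: nAB.
rewrite /pf_sum4 sum4_setU //; try by move=> *; [apply: pf2C12 || apply: pf2C23 || apply: pf2C34].
have -> : sum4 A A A B (pf2 s) = 0.
  apply: big1 => x xA; apply: big1 => y yA; apply: big1 => z zA; apply: big1 => t tB.
  by rewrite /pf2 (s0 x t) // (s0 y t) // (s0 z t) // !mulr0 mul0r subr0 addr0 expr0n.
have -> : sum4 A B B B (pf2 s) = 0.
  apply: big1 => x xA; apply: big1 => y yB; apply: big1 => z zB; apply: big1 => t tB.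
  by rewrite /pf2 (s0 x y) // (s0 x z) // (s0 x t) // !mul0r subr0 addr0 expr0n.
have -> : sum4 A A B B (pf2 s) = dbl_edges A * dbl_edges B.
  rewrite mulr_suml; apply: eq_bigr => x xA; rewrite mulr_suml.
  apply: eq_bigr => y yA; rewrite mulr_sumr; apply: eq_bigr => z zB.
  rewrite mulr_sumr; apply: eq_bigr => t tB.
  by rewrite /pf2 (s0 x z) // (s0 x t) // !mul0r subr0 addr0 exprMn.
ring.
Qed.

Lemma pf_sum3_setU0 w A B : [disjoint A & B] ->
  {in A & B, forall x y, adj x y = 0} ->
  pf_sum3 w (A :|: B) = pf_sum3 w A + pf_sum3 w B + 3 * (dbl_edges A * deg B w) + 3 * (deg A w * dbl_edges B).
Proof.
move=> dAB nAB; rewrite pf_sum3_setU //.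
have s0 x y : x \in A -> y \in B -> s x y = 0.
  by move=> xA yB; apply: adj_eq0 => //; apply: nAB.
congr (_ + _ + 3 * _ + 3 * _).
  rewrite mulr_suml; apply: eq_bigr => x xA; rewrite mulr_suml.
  apply: eq_bigr => y yA; rewrite mulr_sumr; apply: eq_bigr => z zB.
  rewrite /pf2 (s0 x z) // (s0 y z) // !mulr0 subr0 add0r exprMn mulrC //.
rewrite mulr_suml; apply: eq_bigr => x xA; rewrite mulr_sumr.
apply: eq_bigr => y yB; rewrite mulr_sumr; apply: eq_bigr => z zB.
by rewrite /pf2 (s0 x z) // (s0 x y) // !mulr0 subr0 addr0 exprMn.
Qed.

(** The mixed terms come from one edge on each side of w, not both ending in w: there are m_1 m_2 -
    d_1 d_2 such pairs, each of weight 24. *)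
Lemma pf_sum4_cut w A B : [disjoint A & B] -> w \notin A -> w \notin B ->
  {in A & B, forall x y, adj x y = 0} ->
  pf_sum4 (w |: (A :|: B)) = pf_sum4 (w |: A) + pf_sum4 (w |: B) + 6 * (dbl_edges A * dbl_edges B)
    + 12 * (dbl_edges A * deg B w) + 12 * (deg A w * dbl_edges B).
Proof.
move=> dAB wA wB nAB; have wAB : w \notin A :|: B by rewrite inE negb_or wA.
rewrite !pf_sum4_setU1 // pf_sum4_setU // pf_sum3_setU0 //; ring.
Qed.

(** Connectivity of the subgraph induced on X, phrased by cuts: the induction runs over subsets of a
    fixed vertex type, and the negation directly yields a separated set. *)
Definition conn X : bool :=
  [forall A : {set T}, (A \subset X) && (A != set0) && (A != X) ==>
     [exists x in A, [exists y in X :\: A, adj x y == 1]]].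

Lemma connP X : reflect (forall A, A \subset X -> A != set0 -> A != X ->
    exists x y, [/\ x \in A, y \in X, y \notin A & adj x y = 1]) (conn X).
Proof.
apply: (iffP forallP) => [H A sA nA neA|H A].
  have := H A; rewrite sA nA neA /= => /exists_inP [x xA /exists_inP [y]].
  by rewrite inE => /andP [yA yX] /eqP e; exists x, y.
apply/implyP => /andP [/andP [sA nA] neA].
have [x [y [xA yX yA e]]] := H A sA nA neA.
apply/exists_inP; exists x => //; apply/exists_inP; exists y; last exact/eqP.
by rewrite inE yA.
Qed.

Lemma connPn X : ~~ conn X -> exists A, [/\ A \subset X, A != set0, A != X &
  forall x y, x \in A -> y \in X :\: A -> adj x y = 0].
Proof.
rewrite negb_forall => /existsP [A]; rewrite negb_imply => /andP [/andP [/andP [sA nA] neA]].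
move=> /exists_inPn H; exists A; split=> // x y xA yXA.
have /exists_inPn /(_ y yXA) /eqP := H x xA.
by case: (adj01 s_skew x y).
Qed.

(** An edge leaving a subset of A cannot enter B. A subset containing w is treated through its
    complement in [w |: A], which lies in A. *)
Lemma conn_side w A B : [disjoint A & B] -> w \notin A -> w \notin B ->
  {in A & B, forall x y, adj x y = 0} ->
  conn (w |: (A :|: B)) -> conn (w |: A).
Proof.
move=> dAB wA wB nAB /connP cX; apply/connP => D sD nD neD.
have key (D' : {set T}) : D' \subset A -> D' != set0 ->
    exists x y, [/\ x \in D', y \in w |: A, y \notin D' & adj x y = 1].
  move=> sD' nD'; have [||x [y [xD yX yD e]]] := cX D' _ nD'.
  - by apply: (subset_trans sD'); apply/subsetP => z; rewrite !inE => ->; rewrite orbT.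
  - apply: contraNneq wA => eD; apply: (subsetP sD').
    by rewrite eD !inE eqxx.
  exists x, y; split=> //; move: yX; rewrite !inE; case/or3P => [->|->|yB] //.
    by rewrite orbT.
  by have := nAB x y (subsetP sD' x xD) yB; rewrite e.
case: (boolP (w \in D)) => wD; last first.
  apply: key => //; apply/subsetP => x xD; have := subsetP sD x xD.
  by rewrite !inE => /orP [/eqP exw|//]; rewrite exw (negPf wD) in xD.
have [||x [y [xD yX yD e]]] := key ((w |: A) :\: D).
- by apply/subsetP => x; rewrite !inE => /andP [xD /orP [/eqP exw|//]]; rewrite exw wD in xD.
- by apply: contraNneq neD => /eqP; rewrite setD_eq0 eqEsubset sD.
move: xD yD; rewrite !inE => /andP [xD xA]; rewrite negb_and negbK => yD.
exists y, x; split; rewrite ?inE //; last by rewrite adjC.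
by case/orP: yD => //; move: yX; rewrite !inE => ->.
Qed.

Lemma conn_delete X w : conn X -> w \in X -> ~~ conn (X :\ w) ->
  exists A B, [/\ X = w |: (A :|: B), [disjoint A & B],
    [/\ w \notin A, w \notin B, A != set0 & B != set0],
    {in A & B, forall x y, adj x y = 0} & conn (w |: A) /\ conn (w |: B)].
Proof.
move=> cX wX /connPn [A [sA nA neA nAB]].
set B := X :\ w :\: A in nAB.
have dAB : [disjoint A & B].
  by rewrite -setI_eq0; apply/eqP/setP => x; rewrite !inE; case: (x \in A).
have wA : w \notin A by apply/negP => /(subsetP sA); rewrite setD11.
have wB : w \notin B by rewrite !inE eqxx andbF.
have eX : X = w |: (A :|: B).
  by rewrite -{1}(setD1K wX) -(setID (X :\ w) A) (setIidPr sA).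
have nB : B != set0.
  by apply: contraNneq neA => /eqP; rewrite setD_eq0 eqEsubset sA.
exists A, B; split=> //; rewrite eX in cX; split; first exact: conn_side cX.
rewrite (setUC A) in cX; apply: (conn_side _ wB wA _ cX); first by rewrite disjoint_sym.
by move=> x y xB yA; rewrite adjC //; apply: nAB.
Qed.

Lemma dbl_edges_even X : exists m, dbl_edges X = 2 * m.
Proof.
have [k] := ubnP #|X|; elim: k X => // k IH X; rewrite ltnS => leX.
have [->|[w wX]] := set_0Vmem X; first by exists 0; rewrite /dbl_edges big_set0.
have [|m em] := IH (X :\ w); first by move: leX; rewrite (cardsD1 w) wX.
exists (m + deg (X :\ w) w).
by rewrite -{1}(setD1K wX) dbl_edges_setU1 ?setD11 // em; ring.
Qed.

Lemma adj_deg_ge1 A x y : y \in A -> adj x y = 1 -> 1 <= deg A x.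
Proof.
move=> yA e; rewrite /deg (big_setD1 y) //= e lerDl.
exact: deg_ge0.
Qed.

Lemma deg_le_card A x : deg A x <= #|A|%:Z.
Proof.
rewrite -[leRHS]mulr1 -sum_const; apply: ler_sum => y _.
by case: (adj01 s_skew x y) => ->.
Qed.

Lemma conn_deg X w : conn X -> w \in X -> (1 < #|X|)%N -> 1 <= deg X w.
Proof.
move=> /connP cX wX gX; have [|||x [y []]] := cX [set w].
- by rewrite sub1set.
- by apply/set0Pn; exists w; rewrite inE.
- by apply: contraTneq gX => <-; rewrite cards1.
by rewrite inE => /eqP -> yX _ e; apply: adj_deg_ge1 yX e.
Qed.

Lemma conn_edges X : conn X -> X != set0 -> 2 * (#|X|%:Z - 1) <= dbl_edges X.
Proof.
move=> /connP cX nX.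
(* Grow a vertex set from a single vertex; each new vertex brings at least one edge. *)
have H (k : nat) : (k < #|X|)%N ->
    exists A, [/\ A \subset X, #|A| = k.+1 & 2 * k%:Z <= dbl_edges A].
  elim: k => [|k IH] lk.
    have /set0Pn [x xX] := nX.
    by exists [set x]; rewrite sub1set cards1 dbl_edges_set1.
  have [A [sA cA eA]] := IH (ltnW lk).
  have [||x [y [xA yX yA e]]] := cX A sA.
  - by rewrite -cards_eq0 cA.
  - by apply: contraTneq lk => <-; rewrite cA ltnn.
  exists (y |: A); rewrite subUset sub1set yX sA cardsU1 yA cA dbl_edges_setU1 //; split=> //.
  have : 1 <= deg A y by apply: adj_deg_ge1 xA _; rewrite adjC.
  lia.
have [|A [sA cA eA]] := H #|X|.-1; first by rewrite prednK // card_gt0.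
move: cA; rewrite prednK ?card_gt0 // => cA.
have /eqP -> : X == A by rewrite eq_sym eqEcard sA cA /=.
have : (0 < #|X|)%N by rewrite card_gt0.
rewrite cA; lia.
Qed.

Lemma star_decomp X w : w \in X -> exists U R,
  [/\ X = w |: (U :|: R), [disjoint U & R], w \notin U :|: R,
      {in U, forall u, adj w u = 1} & {in R, forall z, adj w z = 0}].
Proof.
move=> wX; exists [set u in X :\ w | adj w u == 1], [set u in X :\ w | adj w u != 1].
split.
- rewrite -{1}(setD1K wX); congr (_ |: _); apply/setP => x; rewrite !inE.
  by case: (_ == 1); rewrite ?andbF ?andbT ?orbF.
- rewrite -setI_eq0; apply/eqP/setP => x; rewrite !inE.
  by case: (_ == 1); rewrite ?andbF.
- by rewrite !inE eqxx.
- by move=> u; rewrite inE => /andP [_ /eqP].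
- by move=> u; rewrite inE => /andP [_ /eqP]; case: (adj01 s_skew w u).
Qed.

Section Star.
Variables (U R : {set T}) (w : T).
Hypotheses (dUR : [disjoint U & R]) (wUR : w \notin U :|: R)
  (wU : {in U, forall u, adj w u = 1}) (wR : {in R, forall z, adj w z = 0}).

Lemma star_deg : deg (w |: (U :|: R)) w = #|U|%:Z.
Proof.
rewrite deg_setU1 // adj_xx // deg_setU // /deg (eq_bigr _ wU) (eq_bigr _ wR).
by rewrite !sum_const; ring.
Qed.

Lemma star_card : #|w |: (U :|: R)|%:Z = 1 + #|U|%:Z + #|R|%:Z.
Proof.
by rewrite cardsU1 wUR cardsU (disjoint_setI0 dUR) cards0 subn0 !PoszD addrA.
Qed.

Lemma star_dbl_edges : dbl_edges (w |: (U :|: R)) =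
  2 * #|U|%:Z + dbl_edges U + dbl_edges R + 2 * \sum_(z in R) deg U z.
Proof.
have := star_deg; rewrite deg_setU1 // adj_xx // add0r => dw.
by rewrite dbl_edges_setU1 // dw dbl_edges_setU // (sum_dgC s_skew U R); ring.
Qed.

Lemma star_pf_sum4 : pf_sum4 (U :|: R) + 4 * pf_sum3 w U
  + 24 * \sum_(z in R) deg U z * (#|U|%:Z - deg U z) + 12 * (#|U|%:Z * dbl_edges R)
  <= pf_sum4 (w |: (U :|: R)).
Proof. by rewrite pf_sum4_setU1 //; have := pf_sum3_star_lb s_skew dUR wU wR; lia. Qed.

End Star.

End LowerBound.

(** * The lower bound *)

Section Minimum.
Import Order.TTheory GRing.Theory Num.Theory.
Local Open Scope ring_scope.
Variables (T : finType) (s : T -> T -> int).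
Hypothesis s_skew : skew_fun s.
Implicit Types (A B D R U X : {set T}).

Local Notation adj := (adj s).
Local Notation deg := (deg s).
Local Notation dbl_edges := (dbl_edges s).
Local Notation pf_sum3 := (pf_sum3 s).
Local Notation pf_sum4 := (pf_sum4 s).
Local Notation conn := (conn s).

(* 24 times the coefficient [a_4] of the oriented graph with two hubs,
   n - 2 other vertices adjacent to one hub and k of them to the other. *)
Definition hub_bound (n k : int) := 24 * (k * (n - 2 - k)).

(** In the star bound with R empty, U spans exactly k = m - n + 1 edges. The nonnegative terms for
    disjoint edges and triangles are kept for the equality case. *)
Lemma universal_lb w U m : w \notin U -> {in U, forall u, adj w u = 1} ->
  dbl_edges (w |: U) = 2 * m ->
  let n := #|w |: U|%:Z in
  hub_bound n (m - n + 1) +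
  6 * (\sum_(x in U) \sum_(y in U) adj x y * dbl_edges (U :\ x :\ y)) + 16 * tri s U
  <= pf_sum4 (w |: U).
Proof.
move=> wU aU; rewrite -(setU0 U).
have d0 : [disjoint U & set0] by rewrite disjoint_sym disjoints_subset sub0set.
have wU0 : w \notin U :|: set0 by rewrite setU0.
have a0 : {in set0, forall z, adj w z = 0} by move=> z; rewrite inE.
have := star_pf_sum4 s_skew d0 wU0 aU a0; rewrite star_card // star_dbl_edges //.
rewrite setU0 /dbl_edges !big_set0 -/(dbl_edges U) cards0 /hub_bound.
have := pf_sum3_nbr_lb s_skew aU; have := pf_sum4_ge0 s U; set S := \sum_(x in U) _.
by move: (pf_sum4 _) (pf_sum4 _) (pf_sum3 _ _) (tri _ _) (dbl_edges U) S #|U| => *; nia.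
Qed.

(** Here v is the only non-neighbour of w. The excess [12 * dbl_edges U] is what makes U independent
    when the bound is attained. *)
Lemma near_universal_lb w v U m : w != v -> w \notin U -> v \notin U ->
  {in U, forall u, adj w u = 1} -> adj w v = 0 -> 1 <= deg U v ->
  dbl_edges (w |: (U :|: [set v])) = 2 * m ->
  let n := #|w |: (U :|: [set v])|%:Z in
  hub_bound n (m - n + 2) + 12 * dbl_edges U <= pf_sum4 (w |: (U :|: [set v])).
Proof.
move=> wv wU vU aU av dv.
have d0 : [disjoint U & [set v]] by rewrite disjoint_sym disjoints1.
have wU0 : w \notin U :|: [set v] by rewrite !inE negb_or wU.
have a0 : {in [set v], forall z, adj w z = 0} by move=> z; rewrite inE => /eqP ->.
have := star_pf_sum4 s_skew d0 wU0 aU a0; rewrite star_card // star_dbl_edges //.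
rewrite !big_set1 dbl_edges_set1 // cards1 /hub_bound.
have [q eq] := dbl_edges_even s_skew U.
have := pf_sum3_nbr_lb s_skew aU; have := pf_sum4_ge0 s (U :|: [set v]); rewrite eq.
have : 0 <= \sum_(x in U) \sum_(y in U) adj x y * dbl_edges (U :\ x :\ y).
  by apply: sumr_ge0 => x _; apply: sumr_ge0 => y _; rewrite mulr_ge0 ?adj_ge0 ?dbl_edges_ge0.
have := tri_ge0 s U; have := dbl_edges_ge0 s U; rewrite eq; move: dv.
set S := \sum_(x in U) _.
move: (pf_sum4 _) (pf_sum4 _) (pf_sum3 _ _) (tri _ _) S (deg _ _) #|U| => P P' Q t S' p d.
move=> p1 q0 t0 S0 P0 h1 h2 em.
have em' : m = d%:Z + q + p by lia.
(* With q edges in U and p neighbours of v there, the star bound exceeds the claim by at least 48 q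
   (p - 1), which is nonnegative as v has a neighbour. *)
rewrite em'; have : 0 <= q * (p - 1) by apply: mulr_ge0; lia.
by nia.
Qed.

Lemma sum_deg_card X (c : int) : {in X, forall x, c <= deg X x} -> #|X|%:Z * c <= dbl_edges X.
Proof. by move=> H; rewrite -sum_const; apply: ler_sum. Qed.

Lemma dbl_edges_deg A x : x \in A -> 2 * deg A x <= dbl_edges A.
Proof.
move=> xA; rewrite -(setD1K xA) dbl_edges_setU1 ?setD11 // deg_setU1 ?setD11 // adj_xx // add0r.
by rewrite lerDr dbl_edges_ge0.
Qed.

(* Arithmetic of gluing two graphs at a vertex; a_i is the number of vertices
   of the i-th part besides that vertex, and d_i the degree of the vertex in it. *)
Lemma glue_bound (a1 a2 k1 k2 d1 d2 P1 P2 P : int) :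
  0 <= k1 -> 0 <= k2 -> 1 <= d1 -> 1 <= d2 -> d1 <= a1 -> d2 <= a2 ->
  d1 + d2 <= a1 + a2 - 2 ->
  (d1 = a1 -> hub_bound (a1 + 1) k1 <= P1) -> (d2 = a2 -> hub_bound (a2 + 1) k2 <= P2) ->
  hub_bound (a1 + 1) k1 <= P1 \/ hub_bound (a1 + 1) (k1 + 1) <= P1 ->
  hub_bound (a2 + 1) k2 <= P2 \/ hub_bound (a2 + 1) (k2 + 1) <= P2 ->
  P1 + P2 + 24 * ((a1 + k1) * (a2 + k2) - d1 * d2) <= P ->
  hub_bound (a1 + a2 + 1) (k1 + k2) < P \/ hub_bound (a1 + a2 + 1) (k1 + k2 + 1) < P.
Proof.
rewrite /hub_bound => k1p k2p d1p d2p d1a d2a dd u1 u2 h1 h2 hP.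
have kk : 0 <= k1 * k2 by apply: mulr_ge0.
have [e1|n1] := eqVneq d1 a1.
  (* The gluing vertex sees all of part 1, so it misses at least two vertices of part 2. *)
  have {u1}h1 := u1 e1.
  have D : d1 * d2 <= a1 * (a2 - 2) by rewrite e1 ler_pM2l; lia.
  by case: h2 => h2; [left|right]; nia.
have [e2|n2] := eqVneq d2 a2.
  have {u2}h2 := u2 e2.
  have D : d1 * d2 <= (a1 - 2) * a2 by rewrite e2 ler_pM2r; lia.
  by case: h1 => {}h1; [left|right]; nia.
(* Now it misses at least one vertex in each part. *)
have D : d1 * d2 <= (a1 - 1) * (a2 - 1) by apply: ler_pM; lia.
by case: h1 => {}h1; case: h2 => {}h2; [left|right|right|right]; nia.
Qed.

Lemma universal_case X w m : w \in X -> deg X w = #|X|%:Z - 1 -> dbl_edges X = 2 * m ->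
  hub_bound #|X|%:Z (m - #|X|%:Z + 1) <= pf_sum4 X.
Proof.
move=> wX; have [U [R [-> dUR wUR wU wR]]] := star_decomp s_skew wX.
rewrite star_deg // star_card // => eR.
have R0 : R = set0 by apply/eqP; rewrite -cards_eq0; apply/eqP; lia.
move: wUR; rewrite R0 setU0 cards0 addr0 => wU' em.
have := universal_lb wU' wU em; rewrite (_ : #|w |: U|%:Z = 1 + #|U|%:Z); last first.
  by rewrite cardsU1 wU'.
have : 0 <= \sum_(x in U) \sum_(y in U) adj x y * dbl_edges (U :\ x :\ y).
  by apply: sumr_ge0 => x _; apply: sumr_ge0 => y _; rewrite mulr_ge0 ?adj_ge0 ?dbl_edges_ge0.
by have := tri_ge0 s U; lia.
Qed.

Lemma near_universal_decomp X w : conn X -> w \in X -> deg X w = #|X|%:Z - 2 ->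
  exists U v, [/\ X = w |: (U :|: [set v]), w != v, w \notin U /\ v \notin U,
    {in U, forall u, adj w u = 1} & adj w v = 0 /\ 1 <= deg U v].
Proof.
move=> cX wX; have [U [R [eX dUR wUR wU wR]]] := star_decomp s_skew wX.
rewrite {1 2}eX star_deg // star_card // => eR.
have /cards1P [v ev] : #|R| == 1%N by apply/eqP; lia.
exists U, v; move: wUR; rewrite ev !inE negb_or => /andP [wU' wv].
have vU : v \notin U by move: dUR; rewrite ev disjoint_sym disjoints1.
have avw : adj w v = 0 by apply: wR; rewrite ev inE.
split=> //; first by rewrite -ev.
split=> //.
have vX : v \in X by rewrite eX ev !inE eqxx !orbT.
have := conn_deg cX vX; rewrite eX deg_setU1; last by rewrite ev !inE negb_or wU'.
rewrite ev deg_setU -?ev // ev deg_set1 adj_xx // adjC // avw add0r addr0; apply.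
by rewrite cardsU1 !inE negb_or wU' wv (cardsD1 v) !inE eqxx orbT.
Qed.

Lemma near_universal_case X w m : conn X -> w \in X -> deg X w = #|X|%:Z - 2 ->
  dbl_edges X = 2 * m -> hub_bound #|X|%:Z (m - #|X|%:Z + 2) <= pf_sum4 X.
Proof.
move=> cX wX dw; have [U [v [-> wv [wU vU] aU [av dv]]]] := near_universal_decomp cX wX dw.
move=> em; have := near_universal_lb wv wU vU aU av dv em; apply: le_trans.
by rewrite lerDl mulr_ge0 ?dbl_edges_ge0.
Qed.

(* The minimum degree d is at most 3, since 2 m < 4 n. *)
Lemma delete_bound U R w m : [disjoint U & R] -> w \notin U :|: R ->
  {in U, forall u, adj w u = 1} -> {in R, forall z, adj w z = 0} ->
  let X := w |: (U :|: R) in let n := #|X|%:Z in let k := m - n + 1 in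
  let d := #|U|%:Z in
  dbl_edges X = 2 * m -> {in X, forall x, deg X x <= n - 3} ->
  {in X, forall x, d <= deg X x} -> 0 <= k -> k <= n - 4 -> 1 <= d ->
  hub_bound (n - 1) (k - d + 1) <= pf_sum4 (U :|: R) \/
  hub_bound (n - 1) (k - d + 2) <= pf_sum4 (U :|: R) ->
  hub_bound n k < pf_sum4 X \/ hub_bound n (k + 1) < pf_sum4 X.
Proof.
move=> dUR wUR wU wR X n k d em dmax dmin k0 kn d1.
have H := sum_deg_card dmin; rewrite -/n em in H.
have d3 : d <= 3.
  have [//|d4] := leP d 3.
  have : n * 4 <= n * d by apply: ler_wpM2l => //; lia.
  by rewrite /k in kn; lia.
have := star_pf_sum4 s_skew dUR wUR wU wR; rewrite -/X -/d.
have P30 := pf_sum3_ge0 s w U.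
have en := star_card dUR wUR; rewrite -/X -/n -/d in en.
have em' := star_dbl_edges s_skew dUR wUR wU wR; rewrite -/X em -/d in em'.
have UX : {subset U <= X} by move=> u uU; rewrite !inE uU !orbT.
have RX : {subset R <= X} by move=> u uR; rewrite !inE uR !orbT.
have ER0 := dbl_edges_ge0 s R; have EU0 := dbl_edges_ge0 s U.
have dgX x : deg X x = adj x w + deg U x + deg R x.
  by rewrite /X deg_setU1 // deg_setU // addrA.
have sU : d + dbl_edges U + \sum_(z in R) deg U z <= d * (n - 3).
  have -> : d + dbl_edges U + \sum_(z in R) deg U z = \sum_(u in U) deg X u.
    under [RHS]eq_bigr do rewrite dgX; rewrite !big_split /= (sum_dgC s_skew R U).
    rewrite [X in _ = X + _ + _](eq_bigr (fun=> 1)) ?sum_const ?mulr1 // => u uU.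
    by rewrite adjC // wU.
  by rewrite -sum_const; apply: ler_sum => u uU; apply/dmax/UX.
have aR z : z \in R -> [/\ 0 <= deg U z, deg U z <= d & d - deg U z <= deg R z].
  move=> zR; split; [exact: deg_ge0 | exact: deg_le_card |].
  by have := dmin z (RX z zR); rewrite dgX adjC // wR // add0r; lia.
(* By the minimum degree, what z lacks in U must be made up inside R. *)
have sR : \sum_(z in R) (d - deg U z) <= dbl_edges R.
  by apply: ler_sum => z /aR [].
have sRE : \sum_(z in R) (d - deg U z) = #|R|%:Z * d - \sum_(z in R) deg U z.
  by rewrite sumrB sum_const.
have [q eq] := dbl_edges_even s_skew U; have [e ee] := dbl_edges_even s_skew R.
rewrite eq in em' EU0 sU; rewrite ee in em' ER0 sR *; rewrite sRE in sR => {eq sRE}.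
have S0 : 0 <= \sum_(z in R) deg U z * (d - deg U z).
  by apply: sumr_ge0 => z /aR [a0 a1 _]; rewrite mulr_ge0 // subr_ge0.
(* A vertex of R with no neighbour in U has at least two in R, hence e >= 2; otherwise every a =
   [deg U z] is 1 or 2, and then a (2 - a) = 2 - a. *)
have S2 : d = 2 -> 2 <= e \/
    \sum_(z in R) (2 - deg U z) <= \sum_(z in R) deg U z * (d - deg U z).
  move=> dd; have [/exists_inP [z zR /eqP az]|aN0] := boolP [exists z in R, deg U z == 0].
    by left; have [_ _] := aR z zR; have := dbl_edges_deg zR; rewrite az ee; lia.
  right; apply: ler_sum => z zR; have [] := aR z zR; have := exists_inPn aN0 z zR.
  rewrite dd; move: (deg U z) => a a0 *.
  by have [->|->] : a = 1 \/ a = 2 by lia.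
rewrite sumrB sum_const in S2.
have [dd|[dd|dd]] : d = 1 \/ d = 2 \/ d = 3 by lia.
- move: S0 em' sU sR; rewrite /hub_bound /k dd.
  move: (\sum_(z in R) deg U z) (\sum_(z in R) _) (pf_sum4 _) (pf_sum4 _) => S S' P P' ????? h.
  by case: h => h; [left|right]; nia.
- have {}S2 := S2 dd; move: S0 S2 em' sU sR; rewrite /hub_bound /k dd.
  move: (\sum_(z in R) deg U z) (\sum_(z in R) _) (pf_sum4 _) (pf_sum4 _) => S S' P P' ? h2 ???? h.
  by case: h => h; case: h2 => h2; [left|left|right|right]; nia.
(* For d = 3 the degree sum [H] says 3 n <= 2 m, and the bound at k is beaten under either
   hypothesis. *)
- move: S0 H em' sU sR; rewrite /hub_bound /k dd.
  move: (\sum_(z in R) deg U z) (\sum_(z in R) _) (pf_sum4 _) (pf_sum4 _) => S S' P P' ?????? h.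
  by case: h => h; left; nia.
Qed.

End Minimum.

(** * The induction on the number of vertices *)

Section Main.
Import Order.TTheory GRing.Theory Num.Theory.
Local Open Scope ring_scope.
Variables (T : finType) (s : T -> T -> int).
Hypothesis s_skew : skew_fun s.
Implicit Types (A B D R U X : {set T}).

Local Notation adj := (adj s).
Local Notation deg := (deg s).
Local Notation dbl_edges := (dbl_edges s).
Local Notation pf_sum3 := (pf_sum3 s).
Local Notation pf_sum4 := (pf_sum4 s).
Local Notation conn := (conn s).

Definition weak_bound X := forall m, dbl_edges X = 2 * m ->
  let n := #|X|%:Z in let k := m - n + 1 in hub_bound n k <= pf_sum4 X \/ hub_bound n (k + 1) <= pf_sum4 X.

Definition strict_bound X := forall m, dbl_edges X = 2 * m ->
  let n := #|X|%:Z in let k := m - n + 1 in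
  {in X, forall x, deg X x <= n - 3} -> k <= n - 4 -> hub_bound n k < pf_sum4 X \/ hub_bound n (k + 1) < pf_sum4 X.

Lemma cut_strict_bound w A B : [disjoint A & B] -> w \notin A -> w \notin B ->
  A != set0 -> B != set0 -> {in A & B, forall x y, adj x y = 0} ->
  conn (w |: A) -> conn (w |: B) -> weak_bound (w |: A) -> weak_bound (w |: B) ->
  strict_bound (w |: (A :|: B)).
Proof.
move=> dAB wA wB nA nB nAB cA cB bA bB m em n k dmax kn.
have wAB : w \notin A :|: B by rewrite inE negb_or wA.
have cardA : #|w |: A|%:Z = #|A|%:Z + 1 by rewrite cardsU1 wA; lia.
have cardB : #|w |: B|%:Z = #|B|%:Z + 1 by rewrite cardsU1 wB; lia.
have en : n = #|A|%:Z + #|B|%:Z + 1.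
  by rewrite /n cardsU1 wAB cardsU (disjoint_setI0 dAB) cards0 subn0; lia.
have dwA : deg (w |: A) w = deg A w by rewrite deg_setU1 // adj_xx // add0r.
have dwB : deg (w |: B) w = deg B w by rewrite deg_setU1 // adj_xx // add0r.
have [mA eA] := dbl_edges_even s_skew (w |: A); have [mB eB] := dbl_edges_even s_skew (w |: B).
have gA : (1 < #|w |: A|)%N by rewrite cardsU1 wA ltnS card_gt0.
have gB : (1 < #|w |: B|)%N by rewrite cardsU1 wB ltnS card_gt0.
have dA1 := conn_deg cA (setU11 w A) gA; have dB1 := conn_deg cB (setU11 w B) gB.
have kA : 2 * (#|w |: A|%:Z - 1) <= dbl_edges (w |: A).
  by apply: conn_edges => //; apply/set0Pn; exists w; rewrite setU11.
have kB : 2 * (#|w |: B|%:Z - 1) <= dbl_edges (w |: B).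
  by apply: conn_edges => //; apply/set0Pn; exists w; rewrite setU11.
have uA : deg (w |: A) w = #|w |: A|%:Z - 1 -> _ :=
  fun h => universal_case s_skew (setU11 w A) h eA.
have uB : deg (w |: B) w = #|w |: B|%:Z - 1 -> _ :=
  fun h => universal_case s_skew (setU11 w B) h eB.
have {bA}bA := bA mA eA; have {bB}bB := bB mB eB.
have EA := dbl_edges_setU1 s_skew wA; have EB := dbl_edges_setU1 s_skew wB.
have Em := dbl_edges_setU1 s_skew wAB; rewrite em dbl_edges_setU // deg_setU // in Em.
rewrite big1 in Em; last by move=> x xA; apply: big1 => y yB; apply: nAB.
have dw := dmax w (setU11 _ _); rewrite deg_setU1 // adj_xx // deg_setU // en add0r in dw.
have dAle := deg_le_card s_skew A w; have dBle := deg_le_card s_skew B w.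
rewrite eA in EA kA; rewrite eB in EB kB.
rewrite dwA dwB cardA cardB /= in kA kB uA uB bA bB dA1 dB1.
(* Cyclomatic numbers add up when two graphs are glued at a vertex. *)
have -> : k = (mA - (#|A|%:Z + 1) + 1) + (mB - (#|B|%:Z + 1) + 1) by rewrite /k en; lia.
rewrite en; apply: (glue_bound _ _ dA1 dB1 dAle dBle _ _ _ bA bB).
- lia.
- lia.
- lia.
- by move=> h; apply: uA; lia.
- by move=> h; apply: uB; lia.
rewrite pf_sum4_cut //.
have -> : dbl_edges A = 2 * (mA - deg A w) by lia.
have -> : dbl_edges B = 2 * (mB - deg B w) by lia.
nia.
Qed.

(** One induction serves both: the strict bound for X uses the weak one on smaller pieces, and the
    weak bound for X reduces to the strict one unless a vertex has degree n - 1 or n - 2, or k > n -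
    4. *)
Lemma bounds X : conn X -> X != set0 -> weak_bound X /\ strict_bound X.
Proof.
have [N] := ubnP #|X|; elim: N X => // N IH X; rewrite ltnS => leX cX nX.
have ke := conn_edges s_skew cX nX.
have sX : strict_bound X.
  move=> m em n k dmax kn.
  have [x0 x0X] := set0Pn _ nX.
  have [w wX dmin] : exists2 w, w \in X & {in X, forall x, deg X w <= deg X x}.
    by case: (Order.TotalTheory.arg_minP (deg X) x0X) => w wX H; exists w.
  have k0 : 0 <= k by rewrite /k /n; lia.
  have gX : (1 < #|X|)%N by lia.
  have d1 := conn_deg cX wX gX.
  have [cY|ncY] := boolP (conn (X :\ w)); last first.
    have [A [B [eX dAB [wA wB nA nB] nAB [cA cB]]]] := conn_delete s_skew cX wX ncY.
    have wAB : w \notin A :|: B by rewrite inE negb_or wA.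
    have cardX : #|X| = (#|A| + #|B|).+1.
      by rewrite eX cardsU1 wAB cardsU (disjoint_setI0 dAB) cards0 subn0.
    move: em dmax kn; rewrite /k /n eX; apply: cut_strict_bound => //.
    - apply: (IH _ _ cA _).1; last by apply/set0Pn; exists w; rewrite setU11.
      by rewrite cardsU1 wA; move: leX nB; rewrite cardX -card_gt0; clear; lia.
    - apply: (IH _ _ cB _).1; last by apply/set0Pn; exists w; rewrite setU11.
      by rewrite cardsU1 wB; move: leX nA; rewrite cardX -card_gt0; clear; lia.
  have [U [R [eX dUR wUR wU wR]]] := star_decomp s_skew wX.
  have eY : X :\ w = U :|: R.
    by rewrite eX setU1K.
  have dw : deg X w = #|U|%:Z by rewrite eX star_deg.
  have cardX : #|X|%:Z = #|U :|: R|%:Z + 1 by rewrite eX cardsU1 wUR; lia.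
  have Em := dbl_edges_setU1 s_skew wUR; rewrite -eX in Em.
  have dw' : deg (U :|: R) w = deg X w by rewrite eX [RHS]deg_setU1 // adj_xx // add0r.
  rewrite eY in cY; have [||bY _] := IH (U :|: R) _ cY _.
  - by move: leX; rewrite -eY (cardsD1 w X) wX.
  - by rewrite -card_gt0; move: gX cardX; clear; lia.
  (* Deleting w removes d edges and one vertex, so k becomes k - d + 1. *)
  have := bY (m - deg X w); rewrite -dw' => {}bY.
  have {}bY := bY ltac:(lia).
  rewrite dw in d1 dmin; rewrite dw' dw in bY.
  have := delete_bound s_skew dUR wUR wU wR; rewrite -eX => H.
  apply: (H m em dmax dmin k0 kn d1).
  rewrite /= cardX in bY *.
  by case: bY => h; [left|right]; move: h; congr (hub_bound _ _ <= _); rewrite /k /n ?cardX; clear; lia.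
split=> // m em n k.
have [h|/exists_inPn h] := boolP [exists w in X, n - 3 < deg X w].
  have /exists_inP [w wX dw] := h.
  have dle : deg X w <= n - 1.
    have [U [R [eX dUR wUR wU wR]]] := star_decomp s_skew wX.
    by rewrite /n eX star_deg // star_card //; lia.
  have [e|e] : deg X w = n - 1 \/ deg X w = n - 2 by lia.
    by left; apply: universal_case e em.
  right; rewrite /k -addrA; exact: near_universal_case e em.
have dmax : {in X, forall x, deg X x <= n - 3} by move=> x xX; rewrite leNgt h.
have [kn|kn] := leP k (n - 4).
  by case: (sX m em dmax kn) => /ltW; [left|right].
(* For k > n - 4 the factor n - 3 - k is nonpositive, so the bound at k + 1 is at most 0. *)
right; apply: le_trans (pf_sum4_ge0 s X); rewrite /hub_bound pmulr_rle0 //.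
by rewrite mulr_ge0_le0 //; rewrite /k /n in kn *; lia.
Qed.
End Main.

(** * Extremal graphs *)

Section TwoHubs.
Import Order.TTheory GRing.Theory Num.Theory.
Local Open Scope ring_scope.
Variables (T : finType) (s : T -> T -> int).
Hypothesis s_skew : skew_fun s.
Implicit Types (A B D R U X : {set T}).

Local Notation adj := (adj s).
Local Notation deg := (deg s).
Local Notation dbl_edges := (dbl_edges s).
Local Notation pf_sum3 := (pf_sum3 s).
Local Notation pf_sum4 := (pf_sum4 s).
Local Notation conn := (conn s).

(** Whether w and v are adjacent is left open, so that both extremal graphs fit. *)
Definition two_hubs w v R := [/\ w != v, w \notin R, v \notin R,
  {in R, forall x, adj w x = 1} & {in R &, forall x y, adj x y = 0}].

(** All two-step walks from w to v through R carry the same sign; this is the equality condition in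
    [two_hubs_lb]. *)
Definition coherent w v R := {in R &, forall x y,
  adj x v = 1 -> adj y v = 1 -> s w x * s x v = s w y * s y v}.

Lemma sum_le0 A (F : T -> int) x : (forall y, 0 <= F y) ->
  \sum_(y in A) F y <= 0 -> x \in A -> F x <= 0.
Proof.
move=> F0 le0 xA; rewrite (big_setD1 x) //= in le0.
by apply: le_trans le0; rewrite lerDl sumr_ge0.
Qed.

Lemma pf_sum3_indep u R : {in R &, forall x y, adj x y = 0} -> pf_sum3 u R = 0.
Proof.
move=> R0; have s0 x y : x \in R -> y \in R -> s x y = 0.
  by move=> xR yR; apply/adj_eq0/R0.
apply: big1 => x xR; apply: big1 => y yR; apply: big1 => z zR.
by rewrite /pf2 (s0 y z) // (s0 x z) // (s0 x y) // !mulr0 subr0 addr0 expr0n.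
Qed.

Lemma pf_sum4_indep R : {in R &, forall x y, adj x y = 0} -> pf_sum4 R = 0.
Proof. by move=> R0; apply: big1 => x xR; apply: pf_sum3_indep. Qed.

(** Every edge meets a hub, so a 4-set with a perfect matching contains both hubs; the matching that
    uses wv drops out because R is independent. *)
Lemma two_hubs_pf_sum4 w v R : two_hubs w v R -> pf_sum4 (w |: (v |: R)) =
  12 * \sum_(x in R) \sum_(y in R) (s w x * s y v - s w y * s x v) ^+ 2.
Proof.
move=> [wv wR vR aR R0].
rewrite !pf_sum4_setU1 ?inE ?negb_or ?wv // pf_sum4_indep // pf_sum3_indep // mulr0 addr0 add0r.
rewrite setUC pf_sum3_setU ?disjoint1U // pf_sum3_indep //.
have -> : pf_sum3 w [set v] = 0.
  by rewrite /pf_sum3 /sum3 !big_set1 /pf2 skew_xx //; ring.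
have -> : sum3 R [set v] [set v] (pf2 s w) = 0.
  by apply: big1 => x _; rewrite !big_set1 /pf2 skew_xx //; ring.
have -> : sum3 R R [set v] (pf2 s w) =
    \sum_(x in R) \sum_(y in R) (s w x * s y v - s w y * s x v) ^+ 2.
  apply: eq_bigr => x xR; apply: eq_bigr => y yR; rewrite big_set1 /pf2.
  by rewrite (adj_eq0 s_skew (R0 x y xR yR)) mulr0 addr0.
ring.
Qed.

Lemma sum_sqr_diff R v :
  \sum_(x in R) \sum_(y in R) (adj x v - adj y v) ^+ 2 =
  2 * (deg R v * (#|R|%:Z - deg R v)).
Proof.
have E x y : (adj x v - adj y v) ^+ 2 = adj x v + adj y v - 2 * (adj x v * adj y v).
  by case: (adj01 s_skew x v) => ->; case: (adj01 s_skew y v) => ->.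
have -> : deg R v = \sum_(x in R) adj x v by apply: eq_bigr => x _; rewrite adjC.
under eq_bigr do under eq_bigr do rewrite E.
under eq_bigr do rewrite sumrB big_split /= sum_const -[X in _ - X]mulr_sumr -mulr_sumr.
rewrite sumrB big_split /= -!mulr_sumr -mulr_suml sum_const; ring.
Qed.

Lemma card_two_hubs w v R : two_hubs w v R -> #|w |: (v |: R)|%:Z = #|R|%:Z + 2.
Proof. by case=> wv wR vR _ _; rewrite !cardsU1 !inE negb_or wv wR vR /=; lia. Qed.

(** Separates the parity of a Pfaffian from its signs: the right-hand side is nonzero only when x
    and y both see v and their walks disagree in sign. Summed over R, the parity parts give
    [hub_bound]. *)
Lemma two_hubs_term w v R x y : two_hubs w v R -> x \in R -> y \in R ->
  (s w x * s y v - s w y * s x v) ^+ 2 - (adj x v - adj y v) ^+ 2 =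
  (s w x * s x v - s w y * s y v) ^+ 2 * (adj x v * adj y v).
Proof.
move=> [_ _ _ aR _] xR yR; have := aR y yR; have := aR x xR.
by case: (adjP s_skew w x) => // _ _; case: (adjP s_skew w y) => // _ _;
  case: (adjP s_skew x v) => _; case: (adjP s_skew y v) => _.
Qed.

Lemma two_hubs_gap w v R : two_hubs w v R ->
  pf_sum4 (w |: (v |: R)) = hub_bound #|w |: (v |: R)|%:Z (deg R v) +
  12 * \sum_(x in R) \sum_(y in R)
    (s w x * s x v - s w y * s y v) ^+ 2 * (adj x v * adj y v).
Proof.
move=> H; rewrite two_hubs_pf_sum4 // card_two_hubs // /hub_bound.
transitivity (12 * (\sum_(x in R) \sum_(y in R) (adj x v - adj y v) ^+ 2) +
  12 * \sum_(x in R) \sum_(y in R)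
    (s w x * s x v - s w y * s y v) ^+ 2 * (adj x v * adj y v)); last first.
  by rewrite sum_sqr_diff; ring.
rewrite -mulrDr -big_split; congr (_ * _); apply: eq_bigr => x xR.
rewrite -big_split; apply: eq_bigr => y yR; rewrite -(two_hubs_term H) //=; ring.
Qed.

Lemma two_hubs_lb w v R : two_hubs w v R ->
  hub_bound #|w |: (v |: R)|%:Z (deg R v) <= pf_sum4 (w |: (v |: R)).
Proof.
move=> H; rewrite two_hubs_gap // lerDl mulr_ge0 //.
by do 2![apply: sumr_ge0 => ? _]; apply: mulr_ge0; rewrite ?sqr_ge0 // mulr_ge0 // adj_ge0.
Qed.

Lemma two_hubs_coherent w v R : two_hubs w v R -> coherent w v R ->
  pf_sum4 (w |: (v |: R)) = hub_bound #|w |: (v |: R)|%:Z (deg R v).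
Proof.
move=> H cR; rewrite two_hubs_gap // big1 ?mulr0 ?addr0 // => x xR.
apply: big1 => y yR.
case: (adj01 s_skew x v) => ax; case: (adj01 s_skew y v) => ay; rewrite ax ay ?mulr0 //.
by rewrite (cR x y) // subrr expr0n.
Qed.

Lemma two_hubs_extremal w v R : two_hubs w v R ->
  pf_sum4 (w |: (v |: R)) <= hub_bound #|w |: (v |: R)|%:Z (deg R v) -> coherent w v R.
Proof.
move=> H; rewrite two_hubs_gap // gerDl => le0 x y xR yR ax ay.
have t0 a b : 0 <= (s w a * s a v - s w b * s b v) ^+ 2 * (adj a v * adj b v).
  by apply: mulr_ge0; rewrite ?sqr_ge0 // mulr_ge0 // adj_ge0.
rewrite pmulr_rle0 // in le0.
have := sum_le0 (fun a => sumr_ge0 _ (fun b _ => t0 a b)) le0 xR.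
move=> /(sum_le0 (t0 x)) /(_ yR).
rewrite ax ay !mulr1 => h; apply/eqP; rewrite -subr_eq0 -sqrf_eq0.
by rewrite eq_le h sqr_ge0.
Qed.

Lemma dbl_edges_eq0 A : dbl_edges A <= 0 -> {in A &, forall x y, adj x y = 0}.
Proof.
move=> le0 x y xA yA; have d0 : deg A x <= 0 by have := dbl_edges_deg s_skew xA; lia.
by case: (adj01 s_skew x y) => // /(adj_deg_ge1 yA); lia.
Qed.

Lemma edge_exists A : 0 < dbl_edges A -> exists x y, [/\ x \in A, y \in A & adj x y = 1].
Proof.
move=> p; have [/exists_inP [x xA /exists_inP [y yA /eqP e]]|h] :=
  boolP [exists x in A, [exists y in A, adj x y == 1]]; first by exists x, y.
move: p; rewrite /dbl_edges big1 // => x xA; apply: big1 => y yA.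
have /exists_inPn /(_ y yA) := exists_inPn h x xA.
by case: (adj01 s_skew x y) => ->.
Qed.

(* The last hypothesis says that any two edges in U meet. *)
Lemma star_center U : 0 < dbl_edges U -> tri s U <= 0 ->
  \sum_(x in U) \sum_(y in U) adj x y * dbl_edges (U :\ x :\ y) <= 0 ->
  exists2 v, v \in U & {in U :\ v &, forall x y, adj x y = 0}.
Proof.
move=> e0 t0 S0; have [a [b [aU bU ab]]] := edge_exists e0.
have term0 x y : 0 <= adj x y * dbl_edges (U :\ x :\ y) by rewrite mulr_ge0 ?adj_ge0 ?dbl_edges_ge0.
have meet x y : x \in U -> y \in U -> adj x y = 1 ->
    {in U :\ x :\ y &, forall z t, adj z t = 0}.
  move=> xU yU e; apply: dbl_edges_eq0.
  have := sum_le0 (fun a => sumr_ge0 _ (fun b _ => term0 a b)) S0 xU.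
  by move=> /(sum_le0 (term0 x)) /(_ yU); rewrite e mul1r.
have no_tri x y z : x \in U -> y \in U -> z \in U -> adj x y = 1 -> adj y z = 1 ->
    adj x z = 1 -> False.
  move=> xU yU zU e1 e2 e3.
  have g i j k : 0 <= adj i j * adj j k * adj i k.
    by apply: mulr_ge0; rewrite ?adj_ge0 // mulr_ge0 // adj_ge0.
  have g' i j : 0 <= \sum_(k in U) adj i j * adj j k * adj i k by apply: sumr_ge0.
  have := sum_le0 (fun i => sumr_ge0 _ (fun j _ => g' i j)) t0 xU.
  by move=> /(sum_le0 (g' x)) /(_ yU) /(sum_le0 (g x y)) /(_ zU); rewrite e1 e2 e3.
(* An edge avoiding p must meet pq, hence ends in q; if q has no neighbour in U besides p, then p is
   the centre. *)
have other p q : p \in U -> q \in U -> adj p q = 1 ->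
    {in U :\ p &, forall x y, adj x y = 0} \/
    exists y, [/\ y \in U, y != p, y != q & adj q y = 1].
  move=> pU qU e; have [h|h] := boolP [exists y in U :\ p :\ q, adj q y == 1].
    right; have /exists_inP [y] := h; rewrite !inE => /and3P [yq yp yU] /eqP.
    by exists y.
  left=> x y xU yU.
  have h' z : z \in U :\ p -> adj q z = 0.
    move=> zU; have [->|zq] := eqVneq z q; first exact: adj_xx.
    have := exists_inPn h z; rewrite inE inE zq => /(_ zU).
    by case: (adj01 s_skew q z) => ->.
  have [->|xq] := eqVneq x q; first exact: h'.
  have [->|yq] := eqVneq y q; first by rewrite adjC // h'.
  by apply: (meet p q) => //; rewrite in_setD1 ?xq ?yq.
have ba : adj b a = 1 by rewrite adjC.
(* If neither a nor b is a centre, there are edges by and az: they close a triangle if y = z and are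
   disjoint otherwise. *)
have [h|[y [yU ya yb eby]]] := other a b aU bU ab; first by exists a.
have [h|[z [zU zb za eaz]]] := other b a bU aU ba; first by exists b.
have [yz|yz] := eqVneq y z; first by case: (no_tri a b y) => //; rewrite yz.
have ab_neq : a != b by apply: contra_eqN ab => /eqP ->; rewrite adj_xx.
have := meet b y bU yU eby a z; rewrite eaz => H.
suff : 1 = 0 :> int by [].
by apply: H; rewrite !inE ?aU ?zU ?ab_neq ?zb ?(eq_sym a) ?ya // eq_sym yz.
Qed.

(** Lying below both bounds contradicts [strict_bound], so some vertex has degree n - 1 or n - 2;
    the excess terms of the matching lower bound then vanish and leave two hubs. *)
Theorem extremal_two_hubs X m : conn X -> dbl_edges X = 2 * m ->
  let n := #|X|%:Z in let k := m - n + 1 in 1 <= k -> k <= n - 4 ->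
  pf_sum4 X <= hub_bound n k -> pf_sum4 X <= hub_bound n (k + 1) ->
  exists w v R, [/\ X = w |: (v |: R), two_hubs w v R, coherent w v R &
    adj w v = 1 /\ deg R v = k \/ adj w v = 0 /\ deg R v = k + 1].
Proof.
move=> cX em n k k1 kn le0 le1.
have nX : X != set0 by apply: contraTneq kn => X0; rewrite /n X0 cards0; lia.
have [/exists_inP [w wX dw]|h] := boolP [exists w in X, n - 3 < deg X w]; last first.
  have dmax : {in X, forall x, deg X x <= n - 3}.
    by move=> x xX; rewrite leNgt (exists_inPn h).
  by case: ((bounds s_skew cX nX).2 m em dmax kn); rewrite ltNge ?le0 ?le1.
have [U [R [eX dUR wUR wU wR]]] := star_decomp s_skew wX.
have edw : deg X w = #|U|%:Z by rewrite eX star_deg.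
have en : n = 1 + #|U|%:Z + #|R|%:Z by rewrite /n eX star_card.
have [R0|R0] := eqVneq R set0.
  move: eX wUR; rewrite R0 setU0 => eX wU'.
  have E2X := dbl_edges_setU1 s_skew wU'; rewrite -eX em in E2X.
  have dwU : deg U w = #|U|%:Z by rewrite -edw eX deg_setU1 // adj_xx // add0r.
  have U0 : 0 < dbl_edges U.
    by move: en; rewrite R0 cards0 => en; rewrite /k in k1; lia.
  have := universal_lb s_skew wU' wU; rewrite -eX => /(_ _ em); rewrite -/n -/k => lb.
  set S := \sum_(x in U) _ in lb.
  have S0 : 0 <= S.
    by do 2![apply: sumr_ge0 => ? _]; rewrite mulr_ge0 ?adj_ge0 ?dbl_edges_ge0.
  have t0 := tri_ge0 s U.
  have := le_trans lb le0; rewrite -addrA gerDl => {}lb.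
  (* Without triangles and disjoint edges, the edges in U form a star, whose centre is the second
     hub. *)
  have [|| v vU ind] := star_center U0.
  - by move: lb S0 t0; move: (tri _ _) S; clear; lia.
  - by rewrite -/S; move: lb S0 t0; move: (tri _ _) S; clear; lia.
  have hubs : two_hubs w v (U :\ v).
    split=> //; rewrite ?setD11 //.
    - by apply: contraNneq wU' => ->.
    - by rewrite inE negb_and wU' orbT.
    - by move=> x; rewrite inE => /andP [_ /wU].
  have EUv := dbl_edges_setU1 s_skew (negbT (setD11 v U)); rewrite setD1K // in EUv.
  have E0 : dbl_edges (U :\ v) = 0 by apply: big1 => x xU; apply: big1 => y yU; apply: ind.
  have eX' : X = w |: (v |: U :\ v) by rewrite setD1K.
  have dv : deg (U :\ v) v = k.
    by move: en; rewrite R0 cards0 /k => en; lia.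
  exists w, v, (U :\ v); split=> //; last by left; rewrite wU.
  by apply: two_hubs_extremal hubs _; rewrite -eX' dv.
have cR : (0 < #|R|)%N by rewrite card_gt0.
have {}edw : deg X w = n - 2 by lia.
have [U' [v [eX' wv [wU' vU'] aU' [av dv]]]] := near_universal_decomp s_skew cX wX edw.
have := near_universal_lb s_skew wv wU' vU' aU' av dv; rewrite -eX' => /(_ _ em).
rewrite -/n => lb.
have ek : m - n + 2 = k + 1 by rewrite /k; lia.
have ind : {in U' &, forall x y, adj x y = 0} by apply: dbl_edges_eq0; have := le_trans lb le1; rewrite ek gerDl; lia.
have hubs : two_hubs w v U' by split.
have eX2 : X = w |: (v |: U') by rewrite eX' [U' :|: _]setUC.
have E0 : dbl_edges U' = 0 by apply: big1 => x xU; apply: big1 => y yU; apply: ind.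
have dv' : deg U' v = k + 1.
  have nv : w \notin v |: U' by rewrite !inE negb_or wv.
  have := dbl_edges_setU1 s_skew nv; rewrite -eX2 em dbl_edges_setU1 // E0 deg_setU1 // av.
  have -> : deg U' w = #|U'|%:Z.
    by rewrite /deg (eq_bigr _ aU') sum_const mulr1.
  have := card_two_hubs hubs; rewrite -eX2 -/n /k => -> H; lia.
exists w, v, U'; split=> //; last by right.
by apply: two_hubs_extremal hubs _; rewrite -eX2 dv'.
Qed.

End TwoHubs.

(** * The spectrum *)

Section Trace.
Import Order.TTheory GRing.Theory Num.Theory.
Local Open Scope ring_scope.
Variables (T : finType) (s : T -> T -> int).
Hypothesis s_skew : skew_fun s.
Implicit Type A : {set T}.

Definition tr4 A := sum4 A A A A (fun x y z t => s x y * s y z * s z t * s t x).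

Lemma sum4D A (g h : T -> T -> T -> T -> int) :
  sum4 A A A A (fun x y z t => g x y z t + h x y z t) = sum4 A A A A g + sum4 A A A A h.
Proof. by rewrite /sum4 -big_split /=; apply: eq_bigr => x _; rewrite -sum3D. Qed.

Lemma sum4Z A c (g : T -> T -> T -> T -> int) :
  sum4 A A A A (fun x y z t => c * g x y z t) = c * sum4 A A A A g.
Proof. by rewrite /sum4 mulr_sumr; apply: eq_bigr => x _; rewrite -sum3Z. Qed.

Lemma eq_sum4 A (g h : T -> T -> T -> T -> int) :
  (forall x y z t, g x y z t = h x y z t) -> sum4 A A A A g = sum4 A A A A h.
Proof. by move=> E; do 4![apply: eq_bigr => ? _]; apply: E. Qed.

Lemma sum4_swap23 A (g : T -> T -> T -> T -> int) :
  sum4 A A A A (fun x y z t => g x z y t) = sum4 A A A A g.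
Proof. by apply: eq_bigr => x _; rewrite /sum3 exchange_big. Qed.

Lemma sum4_swap34 A (g : T -> T -> T -> T -> int) :
  sum4 A A A A (fun x y z t => g x y t z) = sum4 A A A A g.
Proof. by apply: eq_bigr => x _; apply: eq_bigr => y _; rewrite exchange_big. Qed.

(** Newton's identity a_4 = ((tr S^2)^2 - 2 tr S^4) / 8, scaled by 24. In the expanded Pfaffian the
    three squares give pairs of edges and the three cross terms closed walks of length 4. *)
Lemma pf_sum4_trace A : pf_sum4 s A = 3 * dbl_edges s A ^+ 2 - 6 * tr4 A.
Proof.
pose a x y z t := adj s x y * adj s z t.
pose c x y z t := s x y * s y z * s z t * s t x.
have sN x y : s x y = - s y x by exact: s_skew.1.
have Ea : sum4 A A A A a = dbl_edges s A ^+ 2.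
  rewrite expr2 mulr_suml; apply: eq_bigr => x _; rewrite mulr_suml.
  by apply: eq_bigr => y _; rewrite mulr_sumr; apply: eq_bigr => z _; rewrite mulr_sumr.
transitivity (sum4 A A A A (fun x y z t => a x y z t + (a x z y t + (a x t y z +
   (-2 * c x y t z + (-2 * c x y z t + -2 * c x z y t)))))).
  apply: eq_sum4 => x y z t; rewrite /pf2 /a /c /adj.
  rewrite (sN t z) (sN z x) (sN t x) (sN z y); ring.
rewrite !sum4D !sum4Z (sum4_swap23 A a) (sum4_swap23 A c) (sum4_swap34 A c).
have -> : sum4 A A A A (fun x y z t => a x t y z) = sum4 A A A A a.
  by rewrite -(sum4_swap23 A a) -(sum4_swap34 A (fun x y z t => a x z y t)).
rewrite Ea /tr4 -/c; ring.
Qed.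

End Trace.

(** * Eigenvalues of a real skew-symmetric matrix *)

Section Spectrum.
Import Order.TTheory GRing.Theory Num.Theory Num.Def.
Local Open Scope ring_scope.
Local Open Scope sesquilinear_scope.

Lemma char_poly_similar (F : fieldType) n (P A : 'M[F]_n) : P \in unitmx ->
  char_poly (invmx P *m A *m P) = char_poly A.
Proof.
move=> Pu; pose f := map_mx (@polyC F) : 'M_n -> 'M_n.
have E : char_poly_mx (invmx P *m A *m P) = f (invmx P) *m char_poly_mx A *m f P.
  rewrite /char_poly_mx /f mulmxBr mulmxBl -!map_mxM; congr (_ - _).
  by rewrite -scalemx1 -!scalemxAr -!scalemxAl mulmx1 -map_mxM mulVmx // map_mx1.
rewrite /char_poly E !det_mulmx mulrAC -det_mulmx -map_mxM mulVmx //.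
by rewrite map_mx1 det1 mul1r.
Qed.

Lemma char_poly_diag (R : comNzRingType) n (d : 'rV[R]_n) :
  char_poly (diag_mx d) = \prod_(x <- [seq d 0 i | i <- enum 'I_n]) ('X - x%:P).
Proof.
rewrite char_poly_trig; last by apply/is_trig_mxP => i j ij; rewrite mxE -val_eqE ltn_eqF.
rewrite big_map big_enum; apply: eq_bigr => i _.
by rewrite mxE eqxx mulr1n.
Qed.

Lemma eigenvalues_similar_diag (C : numClosedFieldType) n (P : 'M[C]_n) (d : 'rV[C]_n) :
  P \in unitmx ->
  perm_eq (eigenvalues (invmx P *m diag_mx d *m P)) [seq d 0 i | i <- enum 'I_n].
Proof.
move=> Pu; rewrite /eigenvalues; case: closed_field_poly_normal => r /= E.
apply: prod_XsubC_eq; rewrite -char_poly_diag -(char_poly_similar _ Pu) [RHS]E.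
by rewrite (monicP (char_poly_monic _)) scale1r.
Qed.

(** Selecting the rows and columns with nonzero entries leaves an invertible diagonal matrix. This
    serves to bound the number of nonzero eigenvalues by the rank. *)
Lemma rank_diag_mx_ge (F : fieldType) n (d : 'rV[F]_n) :
  (#|[set i | d ord0 i != 0%R]| <= \rank (diag_mx d))%N.
Proof.
set A := [set i | _]; pose f (i : 'I_#|A|) := enum_val i.
pose M := (\matrix_(i < #|A|, j < n) ((f i == j)%:R : F)).
have E : M *m diag_mx d *m M^T = diag_mx (\row_i d ord0 (f i)).
  apply/matrixP => i j; rewrite mul_mx_diag !mxE (bigD1 (f i)) //= !mxE eqxx mul1r.
  rewrite big1 => [|k kf]; last by rewrite !mxE eq_sym (negPf kf) !mul0r.
  rewrite addr0 (inj_eq enum_val_inj) eq_sym.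
  by case: (i == j); rewrite ?mulr1 ?mulr0 ?mulr1n ?mulr0n.
have <- : \rank (diag_mx (\row_i d ord0 (f i))) = #|A|.
  apply: mxrank_unit; rewrite unitmxE det_diag unitfE; apply/prodf_neq0 => i _.
  by rewrite mxE; have := enum_valP i; rewrite inE.
by rewrite -E; apply: leq_trans (mxrankM_maxl _ _) (mxrankM_maxr _ _).
Qed.

(* [t] lists the eigenvalues of the Hermitian matrix [i S]. *)
Lemma skew_spectrum (C : numClosedFieldType) n (S : 'M[C]_n) :
  S^T = - S -> map_mx conjC S = S ->
  exists t : seq C,
  [/\ {in t, forall x, x \is Num.real}, perm_eq t [seq - x | x <- t],
     (\sum_(x <- t) x ^+ 2 = - \tr (S *m S)) /\
     (\sum_(x <- t) x ^+ 4 = \tr (S *m S *m S *m S)),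
     (count (fun x => x != 0%R) t <= \rank S)%N &
     perm_eq (eigenvalues (S ^t* *m S)) [seq x ^+ 2 | x <- t]].
Proof.
move=> St Sr; pose H := 'i *: S.
have hH : H \is hermsymmx.
  apply/is_hermitianmxP; rewrite expr0 scale1r /H linearZ /= St map_mxZ map_mxN Sr.
  by rewrite -[X in X *: - S]/(conjC 'i) conjCi scaleNr scalerN opprK.
have /orthomx_spectralP := hermitian_normalmx hH.
have /mxOverP := hermitian_spectral_diag_real hH.
have := spectral_unit H; set P := spectralmx H; set d := spectral_diag H => Pu dr eH.
have mulP (A B : 'M[C]_n) : (invmx P *m A *m P) *m (invmx P *m B *m P) =
    invmx P *m (A *m B) *m P by rewrite !mulmxA mulmxK.
have trP (A : 'M[C]_n) : \tr (invmx P *m A *m P) = \tr A.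
  by rewrite mxtrace_mulC !mulmxA mulmxV // mul1mx.
have dd (a b : 'rV[C]_n) : diag_mx a *m diag_mx b = diag_mx (\row_j (a 0 j * b 0 j)).
  by apply/matrixP => i j; rewrite mul_mx_diag !mxE; case: eqP => [->|_]; rewrite ?mulr1n // !mulr0n mul0r.
have SS : S *m S = - (H *m H).
  by rewrite /H -scalemxAl -scalemxAr scalerA -expr2 sqrCi scaleN1r opprK.
have HH : H *m H = invmx P *m diag_mx (\row_j (d 0 j ^+ 2)) *m P.
  rewrite eH mulP dd; congr (_ *m diag_mx _ *m _); by apply/rowP => j; rewrite !mxE.
exists [seq d 0 i | i <- enum 'I_n]; split.
- by move=> _ /mapP [i _ ->]; apply: dr.
(* The transpose of [H] is [- H], so both have the same characteristic polynomial and the spectrum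
   is symmetric about 0. *)
- rewrite perm_sym; apply: prod_XsubC_eq; rewrite -char_poly_diag.
  have -> : [seq - x | x <- [seq d 0 i | i <- enum 'I_n]] =
      [seq (- d) 0 i | i <- enum 'I_n].
    by rewrite -map_comp; apply: eq_map => i; rewrite /= mxE.
  rewrite -char_poly_diag -(char_poly_similar _ Pu) -[RHS](char_poly_similar _ Pu) -eH.
  rewrite !linearN /= mulNmx -eH.
  have -> : - H = H^T by rewrite /H [('i *: S)^T]linearZ /= St scalerN.
  by rewrite /char_poly -[RHS]det_tr; congr (\det _); apply/matrixP => i j; rewrite !mxE eq_sym.
- split.
    rewrite SS raddfN /= opprK HH trP /mxtrace big_map big_enum; apply: eq_bigr => i _.
    by rewrite !mxE eqxx mulr1n.
  rewrite -!mulmxA (mulmxA S S) SS mulNmx mulmxN opprK HH mulP trP dd /mxtrace.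
  rewrite big_map big_enum; apply: eq_bigr => i _.
  by rewrite !mxE eqxx mulr1n -exprD.
- have -> : count (fun x => x != 0) [seq d 0 i | i <- enum 'I_n] = #|[set i | d ord0 i != 0]|.
    rewrite count_map -sum1_count big_enum_cond sum1_card.
    by apply: eq_card => i; rewrite !inE.
  apply: leq_trans (rank_diag_mx_ge d) _.
  have -> : diag_mx d = P *m ('i *: S) *m invmx P by rewrite -/H eH !mulmxA mulmxV // mul1mx mulmxK.
  apply: leq_trans (mxrankM_maxl _ _) _; apply: leq_trans (mxrankM_maxr _ _) _.
  by rewrite -mul_scalar_mx mxrankM_maxr.
(* This product is [H *m H], so its eigenvalues are the squares of those of [H]. *)
have -> : S ^t* *m S = invmx P *m diag_mx (\row_j (d 0 j ^+ 2)) *m P.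
  by rewrite St map_mxN Sr mulNmx SS opprK.
rewrite (_ : [seq x ^+ 2 | x <- _] = [seq (\row_j (d 0 j ^+ 2)) 0 i | i <- enum 'I_n]).
  exact: eigenvalues_similar_diag.
by rewrite -map_comp; apply: eq_map => i; rewrite /= mxE.
Qed.

End Spectrum.

(** * From the skew energy to power sums of the positive eigenvalues *)

Section Energy.
Import Order.TTheory GRing.Theory Num.Theory Num.Def.
Local Open Scope ring_scope.
Local Open Scope sesquilinear_scope.
Variable (C : numClosedFieldType).

(** Negation pairs the positive entries with the negative ones, and [g 0 = 0] discards the zeros. It
    is applied to the identity, the second and fourth powers and the indicator of nonzero
    numbers. *)
Lemma sum_norm_symmetric (r : seq C) (g : C -> C) : {in r, forall x, x \is Num.real} ->
  perm_eq r [seq - x | x <- r] -> g 0 = 0 ->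
  \sum_(x <- r) g `|x| = 2 * \sum_(x <- [seq x <- r | 0 < x]) g x.
Proof.
move=> rr pr g0; rewrite big_filter.
have -> : \sum_(x <- r) g `|x| =
    \sum_(x <- r | 0 < x) g x + \sum_(x <- r | x < 0) g (- x).
  rewrite (bigID (fun x => 0 < x)) /=; congr (_ + _).
    by apply: eq_bigr => x x0; rewrite gtr0_norm.
  rewrite [LHS](bigID (fun x => x < 0)) /= [X in _ + X]big_seq_cond [X in _ + X]big1 ?addr0.
    apply: eq_big => x; last by move=> /andP [_ x0]; rewrite ltr0_norm.
    by case: (boolP (x < 0)) => x0; rewrite ?andbF // andbT; rewrite lt_gtF.
  move=> x /andP [xr]; case: (real_ltgtP (rr x xr) (real0 C)) => // -> _.
  by rewrite normr0.
rewrite mulr_natl mulr2n; congr (_ + _); rewrite [RHS](perm_big _ pr) /= big_map.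
by apply: eq_bigl => x; rewrite oppr_gt0.
Qed.

Lemma sum_sqr_le (r : seq C) : {in r, forall x, 0 <= x} ->
  0 <= \sum_(x <- r) x /\ \sum_(x <- r) x ^+ 2 <= (\sum_(x <- r) x) ^+ 2.
Proof.
elim: r => [|y r IH] r0; first by rewrite !big_nil expr0n.
have [|p0 p2] := IH; first by move=> x xr; apply: r0; rewrite inE xr orbT.
have y0 : 0 <= y by apply: r0; rewrite inE eqxx.
rewrite !big_cons; split; first exact: addr_ge0.
by rewrite sqrrD -addrA lerD2l; apply: (le_trans p2); rewrite lerDr mulrn_wge0 // mulr_ge0.
Qed.

(* With e_2 and f_2 the second elementary symmetric functions of r and of the
   squares of r, this is f_2 <= e_2 ^ 2. *)
Lemma power_sum_gap (r : seq C) : {in r, forall x, 0 <= x} ->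
  2 * ((\sum_(x <- r) x ^+ 2) ^+ 2 - \sum_(x <- r) x ^+ 4) <=
  ((\sum_(x <- r) x) ^+ 2 - \sum_(x <- r) x ^+ 2) ^+ 2.
Proof.
elim: r => [|y r IH] r0; first by rewrite !big_nil expr0n /= subrr mulr0 expr0n.
have rr : {in r, forall x, 0 <= x} by move=> x xr; apply: r0; rewrite inE xr orbT.
have [p0 p2] := sum_sqr_le rr; have {}IH := IH rr.
have y0 : 0 <= y by apply: r0; rewrite inE eqxx.
rewrite !big_cons; move: p0 p2 IH.
set a := \sum_(x <- r) x; set b := \sum_(x <- r) _; set c := \sum_(x <- r) _.
move=> p0 p2 IH; rewrite -subr_ge0 in p2; rewrite -subr_ge0 in IH.
rewrite -subr_ge0.
have -> : (((y + a) ^+ 2 - (y ^+ 2 + b)) ^+ 2 -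
    2 * ((y ^+ 2 + b) ^+ 2 - (y ^+ 4 + c))) =
   ((a ^+ 2 - b) ^+ 2 - 2 * (b ^+ 2 - c)) + 4 * (y * a) * (a ^+ 2 - b)
   + 4 * y ^+ 2 * (a ^+ 2 - b) by ring.
apply: addr_ge0; last by apply: mulr_ge0 => //; apply: mulr_ge0; rewrite ?exprn_ge0 ?ler0n.
apply: addr_ge0 => //; apply: mulr_ge0 => //; apply: mulr_ge0; first exact: ler0n.
exact: mulr_ge0.
Qed.

(** For two numbers x and y, f_2 = e_2^2 reads x^2 y^2 = (x y)^2. *)
Lemma power_sum_gap2 (r : seq C) : (size r <= 2)%N ->
  2 * ((\sum_(x <- r) x ^+ 2) ^+ 2 - \sum_(x <- r) x ^+ 4) =
  ((\sum_(x <- r) x) ^+ 2 - \sum_(x <- r) x ^+ 2) ^+ 2.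
Proof. by case: r => [|x [|y []]] //= _; rewrite !(big_cons, big_nil); ring. Qed.

(** With equal sums of squares, a smaller sum means a smaller e_2. Then f_2(p) <= e_2(p)^2 <=
    e_2(q)^2 = f_2(q), and a smaller f_2 means a larger sum of fourth powers. *)
Lemma power_sum4_le (p q : seq C) : {in p, forall x, 0 <= x} ->
  {in q, forall x, 0 <= x} -> (size q <= 2)%N ->
  \sum_(x <- p) x ^+ 2 = \sum_(x <- q) x ^+ 2 ->
  \sum_(x <- p) x <= \sum_(x <- q) x ->
  \sum_(x <- q) x ^+ 4 <= \sum_(x <- p) x ^+ 4.
Proof.
move=> p0 q0 sq e2 le1; have gp := power_sum_gap p0; have gq := power_sum_gap2 sq.
have [p10 p1] := sum_sqr_le p0; have [q10 q1] := sum_sqr_le q0.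
rewrite -e2 in gq q1.
have H : 2 * ((\sum_(x <- p) x ^+ 2) ^+ 2 - \sum_(x <- p) x ^+ 4) <=
    2 * ((\sum_(x <- p) x ^+ 2) ^+ 2 - \sum_(x <- q) x ^+ 4).
  apply: (le_trans gp); rewrite gq ler_pXn2r ?nnegrE ?subr_ge0 //.
  by rewrite lerD2r ler_pXn2r ?nnegrE.
by rewrite ler_pM2l ?ltr0n // lerD2l lerN2 in H.
Qed.

Section Graph.
Variables (n : nat) (G : orgraph n).

Definition sgn_fun (i j : 'I_n) : int := skew_adj int G i j.

Lemma sgn_funE i j : sgn_fun i j = if G i j then 1 else if G j i then -1 else 0.
Proof. by rewrite /sgn_fun mxE. Qed.

Lemma sgn_fun_skew : skew_fun sgn_fun.
Proof.
split=> i j; rewrite !sgn_funE.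
  by have := @arc_asym _ G i j; case: (G i j); case: (G j i) => // /(_ isT).
by case: ifP => // _; case: ifP.
Qed.

Lemma skew_adj_intr i j : skew_adj C G i j = (sgn_fun i j)%:~R.
Proof. by rewrite mxE sgn_funE; case: ifP => // _; case: ifP => // _; rewrite rmorphN1. Qed.

Lemma tr_skew_adj2 : - \tr (skew_adj C G *m skew_adj C G) = (dbl_edges sgn_fun setT)%:~R.
Proof.
rewrite /mxtrace -sumrN /dbl_edges /deg rmorph_sum /= [RHS](eq_bigl predT); last first.
  by move=> x; rewrite inE.
apply: eq_bigr => i _; rewrite mxE -sumrN rmorph_sum /= [RHS](eq_bigl predT); last first.
  by move=> x; rewrite inE.
apply: eq_bigr => j _; rewrite !skew_adj_intr (sgn_fun_skew.1 j i) /adj rmorphXn rmorphN /=.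
by rewrite mulrN opprK expr2.
Qed.

Lemma tr_skew_adj4 :
  let S := skew_adj C G in \tr (S *m S *m S *m S) = (tr4 sgn_fun setT)%:~R.
Proof.
move=> S; have sumT (F : 'I_n -> int) :
    (\sum_(i in [set: 'I_n]) F i)%:~R = \sum_i (F i)%:~R :> C.
  by rewrite rmorph_sum /=; apply: eq_bigl => x; rewrite inE.
rewrite /tr4 /sum4 sumT; apply: eq_bigr => i _; rewrite /sum3 sumT.
rewrite mxE.
under eq_bigr do rewrite mxE mulr_suml.
rewrite exchange_big /=.
under eq_bigr do under eq_bigr do rewrite mxE mulr_suml mulr_suml.
under eq_bigr do rewrite exchange_big /=.
rewrite exchange_big /=; apply: eq_bigr => j _; rewrite sumT; apply: eq_bigr => k _.
rewrite sumT; apply: eq_bigr => l _.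
by rewrite !skew_adj_intr !rmorphM.
Qed.

(** The list p holds the positive eigenvalues of i S; the symmetry of the spectrum accounts for
    every factor 2. *)
Lemma skew_energy_spectrum : exists p : seq C,
  [/\ {in p, forall x, 0 <= x}, skew_energy C G = 2 * \sum_(x <- p) x,
     2 * \sum_(x <- p) x ^+ 2 = (dbl_edges sgn_fun setT)%:~R,
     2 * \sum_(x <- p) x ^+ 4 = (tr4 sgn_fun setT)%:~R &
     (2 * size p <= \rank (skew_adj C G))%N].
Proof.
have St : (skew_adj C G)^T = - skew_adj C G.
  apply/matrixP => i j; rewrite [LHS]mxE [RHS]mxE !skew_adj_intr (sgn_fun_skew.1 j i).
  by rewrite rmorphN.
have Sr : map_mx conjC (skew_adj C G) = skew_adj C G.
  by apply/matrixP => i j; rewrite [LHS]mxE skew_adj_intr; apply: rmorph_int.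
have [t [tr pt [t2 t4] ct et]] := skew_spectrum St Sr.
have half := fun g => sum_norm_symmetric tr pt (g := g).
exists [seq x <- t | 0 < x]; split.
- by move=> x; rewrite mem_filter => /andP [/ltW].
- rewrite /skew_energy /singular_values big_map (perm_big _ et) /= big_map.
  rewrite -(half id) //; rewrite !big_seq; apply: eq_bigr => x xt.
  by rewrite -real_normK ?tr // sqrCK.
- rewrite -(half (fun x => x ^+ 2)) ?expr0n // -tr_skew_adj2 -t2 !big_seq.
  by apply: eq_bigr => x xt; rewrite real_normK ?tr.
- rewrite -(half (fun x => x ^+ 4)) ?expr0n // -tr_skew_adj4 -t4 !big_seq.
  by apply: eq_bigr => x xt; rewrite -[4%N]/(2 * 2)%N !exprM real_normK ?tr.
(* The same halving, applied to the indicator of nonzero numbers, counts the nonzero eigenvalues. *)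
apply: leq_trans ct; have := half (fun x => (x != 0)%:R); rewrite eqxx => /(_ erefl).
rewrite big_filter.
have -> : \sum_(x <- t) (`|x| != 0)%:R = (count (fun x => x != 0) t)%:R :> C.
  rewrite -sum1_count natr_sum [RHS]big_mkcond; apply: eq_bigr => x _.
  by rewrite normr_eq0; case: (x == 0).
have -> : \sum_(x <- t | 0 < x) (x != 0)%:R = (size [seq x <- t | 0 < x])%:R :> C.
  rewrite size_filter -sum1_count natr_sum; apply: eq_bigr => x x0.
  by rewrite gt_eqF.
by rewrite -natrM => /eqP; rewrite eqr_nat => /eqP ->.
Qed.

End Graph.

(** Rank at most 4 leaves [H] at most two positive eigenvalues, where the estimate of energy by a_4
    is an equality; so the inequality of energies passes to a_4. *)
Lemma energy_pf_sum4 n (G H : orgraph n) : dbl_edges (sgn_fun G) setT = dbl_edges (sgn_fun H) setT ->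
  (\rank (skew_adj C H) <= 4)%N -> skew_energy C G <= skew_energy C H ->
  pf_sum4 (sgn_fun G) setT <= pf_sum4 (sgn_fun H) setT.
Proof.
move=> eE rH; have [p [p0 -> p2 p4 _]] := skew_energy_spectrum G.
have [q [q0 -> q2 q4 sq]] := skew_energy_spectrum H.
rewrite ler_pM2l ?ltr0n // => le1.
have {}sq : (size q <= 2)%N by lia.
have e2 : \sum_(x <- p) x ^+ 2 = \sum_(x <- q) x ^+ 2.
  by apply: (@mulfI _ 2); rewrite ?pnatr_eq0 // p2 q2 eE.
have := power_sum4_le p0 q0 sq e2 le1.
rewrite -(ler_pM2l (ltr0n C 2)) p4 q4 ler_int => h.
rewrite !pf_sum4_trace ?eE; [|exact: sgn_fun_skew..]; lia.
Qed.

End Energy.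

(** * The oriented graphs O^+ and B^+ *)

Section Final.
Import Order.TTheory GRing.Theory Num.Theory.
Local Open Scope ring_scope.

Lemma sum_setT (T : finType) (F : T -> int) : \sum_(i in [set: T]) F i = \sum_i F i.
Proof. by apply: eq_bigl => x; rewrite inE. Qed.

Section Basic.
Variables (n : nat) (G : orgraph n).
Local Notation s := (sgn_fun G).

Lemma sgn_fun_arc i j : (s i j == 1) = G i j.
Proof. by rewrite sgn_funE; case: (G i j); case: (G j i). Qed.

Lemma adj_edge i j : adj s i j = (G i j || G j i)%:Z.
Proof. by rewrite /adj sgn_funE; case: (G i j); case: (G j i). Qed.

Lemma dbl_edges_num_arcs : dbl_edges s setT = 2 * (num_arcs G)%:Z.
Proof.
have E : (num_arcs G)%:Z = \sum_i \sum_j (G i j)%:Z.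
  rewrite /num_arcs -sum1_card big_mkcond /= pair_big /=.
  rewrite -natz natr_sum; apply: eq_bigr => -[i j] _ /=; rewrite inE /=.
  by case: (G i j).
rewrite /dbl_edges /deg sum_setT.
transitivity (\sum_i \sum_j ((G i j)%:Z + (G j i)%:Z)).
  apply: eq_bigr => i _; rewrite sum_setT; apply: eq_bigr => j _; rewrite adj_edge.
  by have := @arc_asym _ G i j; case: (G i j); case: (G j i) => // /(_ isT).
under eq_bigr do rewrite big_split /=; rewrite big_split /= [X in _ + X]exchange_big -E.
lia.
Qed.

Lemma connected_conn : connected G -> conn s setT.
Proof.
move=> cG; apply/contraT => /(connPn (sgn_fun_skew G)) [A [_ /set0Pn [x xA] neA nAB]].
have [y yA] : exists y, y \notin A.
  apply/existsP; rewrite -negb_forall; apply: contra neA => /forallP h.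
  by apply/eqP/setP => y; rewrite h inE.
suff cl : closed (edge G) A.
  by move: (closed_connect cl (cG x y)); rewrite /= xA (negPf yA).
have key a b : edge G a b -> a \in A -> b \in A.
  move=> e aA; apply/contraT => bA; have := nAB a b aA.
  by rewrite inE bA inE => /(_ isT); rewrite adj_edge; move: e; rewrite /edge /= => ->.
move=> a b e; apply/idP/idP; apply: key => //.
by move: e; rewrite /edge /= orbC.
Qed.

Lemma dbl_edges_two_hubs w v R : two_hubs s w v R ->
  dbl_edges s (w |: (v |: R)) = 2 * (#|R|%:Z + deg s R v + adj s w v).
Proof.
have sk := sgn_fun_skew G; move=> [wv wR vR aR R0].
have E0 : dbl_edges s R = 0 by apply: big1 => x xR; apply: big1 => y yR; apply: R0.
rewrite !dbl_edges_setU1 ?inE ?negb_or ?wv // E0 deg_setU1 //.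
have -> : deg s R w = #|R|%:Z by rewrite /deg (eq_bigr _ aR) sum_const mulr1.
ring.
Qed.

(** The matrix vanishes on pairs from R, so it is carried by the two rows and the two columns of the
    hubs, each pair contributing rank at most 2. *)
Lemma rank_two_hubs (C : numClosedFieldType) w v R : two_hubs s w v R ->
  w |: (v |: R) = setT -> (\rank (skew_adj C G) <= 4)%N.
Proof.
move=> [wv wR vR aR R0] eT; set S := skew_adj C G.
have inR x : [|| x == w, x == v | x \in R].
  by have := in_setT x; rewrite -eT !inE.
(* The coordinate projection onto w and v. *)
pose D : 'M[C]_n := delta_mx w w + delta_mx v v.
have rD : (\rank D <= 2)%N.
  by apply: leq_trans (mxrank_add _ _) _; rewrite !mxrank_delta.
have DE x y : D x y = ((x == y) && (x \notin R))%:R.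
  rewrite !mxE; have /or3P [/eqP->|/eqP->|xR] := inR x.
  - by rewrite (negPf wv) addr0 wR andbT eqxx eq_sym.
  - by rewrite eq_sym (negPf wv) add0r vR andbT eqxx eq_sym.
  have -> : (x == w) = false by apply: contraNF wR => /eqP <-.
  have -> : (x == v) = false by apply: contraNF vR => /eqP <-.
  by rewrite xR andbF /= addr0.
have mulD x y (A : 'M[C]_n) : (D *m A) x y = (x \notin R)%:R * A x y.
  rewrite mxE (bigD1 x) //= DE eqxx big1 ?addr0 // => k kx.
  by rewrite DE eq_sym (negPf kx) mul0r.
have Dmul x y (A : 'M[C]_n) : (A *m D) x y = A x y * (y \notin R)%:R.
  rewrite mxE (bigD1 y) //= DE eqxx big1 ?addr0 // => k kx.
  by rewrite DE (negPf kx) mulr0.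
have -> : S = D *m S + (1%:M - D) *m S *m D.
  apply/matrixP => x y; rewrite [RHS]mxE Dmul mulD mulmxBl mul1mx [(S - _) x y]mxE.
  rewrite [(- (D *m S)) x y]mxE mulD.
  have [xR|xR] /= := boolP (x \in R); last by rewrite !mul1r subrr mul0r addr0.
  have [yR|yR] /= := boolP (y \in R); last by rewrite !mul0r subr0 mulr1 add0r.
  rewrite mul0r add0r mulr0 /S skew_adj_intr (adj_eq0 (sgn_fun_skew G)) //.
  exact: R0.
apply: leq_trans (mxrank_add _ _) _; rewrite -[4%N]/(2 + 2)%N; apply: leq_add.
  exact: leq_trans (mxrankM_maxl _ _) rD.
exact: leq_trans (mxrankM_maxr _ _) rD.
Qed.

End Basic.

(* O^+_{n,m} is the case K = m - n + 1, b = true and B^+_{n,m} the case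
   K = m - n + 2, b = false. *)
Definition hub_arc n K b : rel 'I_n := fun i j =>
  ((i == 0 :> nat) && ((1 < j) || b && (j == 1 :> nat))
   || (1 < i < K + 2) && (j == 1 :> nat))%N.

Lemma Oplus_hub n m : Oplus n m =2 @hub_arc n (m - n + 1) true.
Proof. by move=> i j; rewrite /= /Oplus_arc /hub_arc; lia. Qed.

Lemma Bplus_hub n m : (n <= m)%N -> Bplus n m =2 @hub_arc n (m - n + 2) false.
Proof. by move=> nm i j; rewrite /= /Bplus_arc /= /Oplus_arc /hub_arc; lia. Qed.

(** * The two-hub model and graphs isomorphic to it *)

Section Model.
Variables (n K : nat) (b : bool) (H : orgraph n).
Hypotheses (HE : H =2 @hub_arc n K b) (gn : (2 < n)%N) (Kn : (K <= n - 2)%N).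
Local Notation s := (sgn_fun H).

Definition hub0 : 'I_n := Ordinal (ltn_trans (ltn_trans (ltnSn 0) (ltnSn 1)) gn).
Definition hub1 : 'I_n := Ordinal (ltn_trans (ltnSn 1) gn).
Definition others : {set 'I_n} := [set i : 'I_n | (1 < i)%N].

Lemma model_setT : hub0 |: (hub1 |: others) = setT.
Proof. by apply/setP => -[[|[|i]] li]; rewrite !inE. Qed.

Lemma model_two_hubs : two_hubs s hub0 hub1 others.
Proof.
split; rewrite ?inE //.
- by move=> x; rewrite inE adj_edge !HE /hub_arc /= => ->.
- move=> x y; rewrite !inE adj_edge !HE /hub_arc => x1 y1.
  by case: orP => //; lia.
Qed.

Lemma model_coherent : coherent s hub0 hub1 others.
Proof.
have E x : x \in others -> adj s x hub1 = 1 -> s hub0 x * s x hub1 = 1.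
  rewrite inE adj_edge => x1; rewrite !sgn_funE !HE /hub_arc /= x1 /= andbT.
  have -> : (nat_of_ord x == 0%N) = false by lia.
  by rewrite /= orbF; case: ifP.
by move=> x y xR yR ax ay; rewrite !E.
Qed.

Lemma model_adj : adj s hub0 hub1 = b%:Z.
Proof. by rewrite adj_edge !HE /hub_arc /= andbT !orbF. Qed.

Lemma card_others : #|others| = (n - 2)%N.
Proof.
have := card_two_hubs model_two_hubs; rewrite model_setT cardsT card_ord.
by have := gn; move: #|others| => k h e; lia.
Qed.

Lemma count_interval (p : nat) :
  (\sum_(0 <= i < p | 1 < i < K + 2) 1 = minn p (K + 2) - 2)%N.
Proof.
rewrite big_mkcond /=; elim: p => [|p IH]; first by rewrite big_geq //; lia.
rewrite big_nat_recr //= IH; case: ifP => h; lia.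
Qed.

Lemma model_deg : deg s others hub1 = K%:Z.
Proof.
have -> : deg s others hub1 = (\sum_(i < n | (1 < i < K + 2)%N) 1)%N%:Z.
  rewrite -natz natr_sum /deg big_mkcond [RHS]big_mkcond; apply: eq_bigr => i _.
  rewrite inE adj_edge !HE /hub_arc /= andbT.
  have [->|i0] := eqVneq (nat_of_ord i) 0%N; first by [].
  by case: (1 < i)%N => //=; case: (i < K + 2)%N.
rewrite -(big_mkord (fun i => 1 < i < K + 2)%N (fun=> 1%N)) count_interval.
congr Posz; lia.
Qed.

Lemma model_num_arcs : num_arcs H = (n - 2 + K + b)%N.
Proof.
have := dbl_edges_two_hubs model_two_hubs.
rewrite model_setT dbl_edges_num_arcs model_deg model_adj card_others; lia.
Qed.

Lemma model_connected : b || (0 < K)%N -> connected H.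
Proof.
move=> bK.
have sym : connect_sym (edge H).
  by apply: sym_connect_sym => x y; rewrite /edge /= orbC.
have root j : connect (edge H) hub0 j.
  have R (x : 'I_n) : (1 < x)%N -> connect (edge H) hub0 x.
    by move=> x1; apply: connect1; rewrite /edge /= !HE /hub_arc /= x1.
  have [j1|j1] := ltnP 1 j; first exact: R.
  have [j0|j0] := eqVneq (nat_of_ord j) 0%N.
    by rewrite (_ : hub0 = j) //; apply/val_inj; rewrite /= j0.
  have {j0}j1 : nat_of_ord j = 1%N by lia.
  case/orP: bK => h.
    by apply: connect1; rewrite /edge /= !HE /hub_arc /= h j1.
  (* Without an arc between the hubs, the second hub is reached through the vertex of index 2, which
     sees it because K > 0. *)
  apply: connect_trans (R (Ordinal gn) _) _ => //.
  by apply: connect1; rewrite /edge /= !HE /hub_arc /= j1 eqxx andbT; apply/orP; left; lia.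
by move=> i j; apply: connect_trans (root j); rewrite sym.
Qed.

Lemma model_pf_sum4 : pf_sum4 s setT = hub_bound n%:Z K%:Z.
Proof.
have := two_hubs_coherent (sgn_fun_skew H) model_two_hubs model_coherent.
by rewrite model_setT model_deg cardsT card_ord.
Qed.

Lemma model_rank (C : numClosedFieldType) : (\rank (skew_adj C H) <= 4)%N.
Proof. exact: rank_two_hubs model_two_hubs model_setT. Qed.

Section Iso.
Variables (G : orgraph n) (w v : 'I_n) (R : {set 'I_n}).
Hypotheses (wv : w != v) (wR : w \notin R) (vR : v \notin R)
  (eT : w |: (v |: R) = setT).

Lemma isomorphic_model (N : {set 'I_n}) : N \subset R -> #|N| = K ->
  (forall i j, G i j = (i == w) && ((j \in R) || b && (j == v)) || (i \in N) && (j == v)) ->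
  isomorphic G H.
Proof.
move=> sNR cN GE.
(* The position in this list is the isomorphism: w and v take 0 and 1, N takes 2 to K + 1, and the
   rest of R follows. *)
pose L := w :: v :: (enum N ++ enum (R :\: N)).
have memL x : x \in L.
  have := in_setT x; rewrite -eT !inE mem_cat !mem_enum !inE.
  by case: (x == w); case: (x == v) => //=; case: (x \in N).
have sizeL : size L = n.
  have : #|w |: (v |: R)| = n by rewrite eT cardsT card_ord.
  rewrite /L /= size_cat -!cardE !cardsU1 !inE negb_or wv wR vR /= => eR.
  have := subset_leq_card sNR; rewrite cardsD (setIidPr sNR) -[RHS]eR.
  by move: #|N| #|R| => k l; lia.
have ltL x : (index x L < n)%N by rewrite -[X in (_ < X)%N]sizeL index_mem.
pose f0 x : 'I_n := Ordinal (ltL x).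
have f_inj : injective f0.
  move=> x y exy; have e : index x L = index y L := congr1 val exy.
  by rewrite -(nth_index w (memL x)) e nth_index.
have f_w : index w L = 0%N by rewrite /= eqxx.
have f_v : index v L = 1%N by rewrite /= (negPf wv) eqxx.
have f_R x : x \in R -> index x L = (index x (enum N ++ enum (R :\: N))).+2.
  move=> xR; have wx : (w == x) = false by apply: contraNF wR => /eqP ->.
  have vx : (v == x) = false by apply: contraNF vR => /eqP ->.
  by rewrite /L /= wx vx.
have f_N x : x \in R -> (index x L < K + 2)%N = (x \in N).
  move=> xR; rewrite f_R // index_cat mem_enum -cN cardE.
  have [xN|xN] := boolP (x \in N); rewrite addn2 !ltnS.
    by rewrite index_mem mem_enum.
  by rewrite ltnNge leq_addr.
have cases x : [\/ x = w, x = v | x \in R].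
  by have := in_setT x; rewrite -eT !inE => /or3P [/eqP|/eqP|];
    [constructor 1|constructor 2|constructor 3].
have NR x : x \in N -> x \in R by apply: (subsetP sNR).
have e0 x : (index x L == 0%N) = (x == w).
  case: (cases x) => [->|->|xR]; rewrite ?f_w ?f_v ?eqxx //.
    by rewrite [v == w]eq_sym (negPf wv).
  by rewrite f_R //; apply/esym/negbTE; apply: contraNneq wR => <-.
have e1 x : (index x L == 1%N) = (x == v).
  case: (cases x) => [->|->|xR]; rewrite ?f_w ?f_v ?eqxx // ?(negPf wv) //.
  by rewrite f_R //; apply/esym/negbTE; apply: contraNneq vR => <-.
have e2 x : (1 < index x L)%N = (x \in R).
  by case: (cases x) => [->|->|xR]; rewrite ?f_w ?f_v ?(negPf wR) ?(negPf vR) // f_R // xR.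
have e3 x : (1 < index x L < K + 2)%N = (x \in N).
  rewrite e2; have [xR|xR] /= := boolP (x \in R); first exact: f_N.
  by apply/esym/negbTE; apply: contra xR; apply: NR.
exists (perm f_inj) => i j; rewrite !permE HE GE /hub_arc /=.
by rewrite -/L e3 !e0 !e1 !e2.
Qed.

End Iso.
End Model.
End Final.

(** * Switching *)

Section Switching.
Import Order.TTheory GRing.Theory Num.Theory.
Local Open Scope ring_scope.
Variables (n : nat).
Implicit Types (G H : orgraph n).

Definition sign (W : {set 'I_n}) (x : 'I_n) : int := if x \in W then -1 else 1.

Lemma sgn_fun_switch W G i j :
  sgn_fun (switch W G) i j = sign W i * sign W j * sgn_fun G i j.
Proof.
rewrite !sgn_funE /= /switch_arc /sign eq_sym.
have := @arc_asym _ G i j.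
by case: (i \in W); case: (j \in W) => /=; case: (G i j); case: (G j i) => // /(_ isT).
Qed.

Lemma sgn_fun_converse G i j : sgn_fun (converse G) i j = - sgn_fun G i j.
Proof. by rewrite (sgn_fun_skew _).1 !sgn_funE /=. Qed.

Lemma adj_converse G i j : adj (sgn_fun (converse G)) i j = adj (sgn_fun G) i j.
Proof. by rewrite /adj sgn_fun_converse sqrrN. Qed.

Lemma two_hubs_converse G w v R :
  two_hubs (sgn_fun G) w v R -> two_hubs (sgn_fun (converse G)) w v R.
Proof.
move=> [wv wR vR aR R0]; split=> //.
  by move=> x xR; rewrite adj_converse aR.
by move=> x y xR yR; rewrite adj_converse R0.
Qed.

(** Here eps is the common sign of the walks from w to v through R; switching alone suffices when an
    arc between the hubs has this sign too. *)
Lemma switch_model K (b : bool) G H w v R eps :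
  H =2 @hub_arc n K b -> (2 < n)%N -> (K <= n - 2)%N ->
  two_hubs (sgn_fun G) w v R -> w |: (v |: R) = setT ->
  deg (sgn_fun G) R v = K%:Z -> eps ^+ 2 = 1 ->
  {in R, forall x, adj (sgn_fun G) x v = 1 -> sgn_fun G w x * sgn_fun G x v = eps} ->
  sgn_fun G w v = b%:Z * eps ->
  exists W, isomorphic (switch W G) H.
Proof.
set s := sgn_fun G; move=> HE gn Kn hubs eT dK e2 prod swv.
have [wv wR vR aR R0] := hubs; have sk : skew_fun s := sgn_fun_skew G.
(* Switching these x turns all arcs at w outwards; every arc between R and v then has sign eps, so v
   is switched as well when eps is -1. *)
pose W := [set x in R | s w x == -1] :|: (if eps == -1 then [set v] else set0).
have eps1 : eps = 1 \/ eps = -1.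
  by have := mulf_eq0 (eps - 1) (eps + 1); rewrite -subr_sqr_1 e2 subrr eqxx; lia.
have sw : sign W w = 1.
  rewrite /sign !inE (negPf wR) /=.
  by case: ifP; rewrite ?inE //; case: ifP; rewrite !inE ?(negPf wv).
have sv : sign W v = eps.
  by rewrite /sign !inE (negPf vR) /=; case: eps1 => -> /=; rewrite ?inE ?eqxx //.
have sR x : x \in R -> sign W x = s w x.
  move=> xR; rewrite /sign !inE xR /=.
  have -> : (x \in if eps == -1 then [set v] else set0) = false.
    by case: ifP; rewrite !inE //; move=> _; apply: contraNF vR => /eqP <-.
  by have := aR x xR; case: (adjP sk w x).
pose N := [set x in R | adj s x v == 1].
exists W; have [|||f Hf] := @isomorphic_model n K b H HE gn Kn (switch W G) w v R wv wR vR eT N; last by exists f.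
- by apply/subsetP => x; rewrite inE => /andP [].
- suff : (#|N|%:Z = K%:Z :> int) by case.
  rewrite -dK -[LHS]mulr1 -sum_const /deg big_mkcond [RHS]big_mkcond.
  apply: eq_bigr => x _; rewrite inE; case: (x \in R) => //=.
  by rewrite [adj s v x]adjC //; case: (adj01 sk x v) => ->.
have cases x : [\/ x = w, x = v | x \in R].
  by have := in_setT x; rewrite -eT !inE => /or3P [/eqP|/eqP|];
    [constructor 1|constructor 2|constructor 3].
have Nw : (w \in N) = false by rewrite inE (negPf wR).
have Nv : (v \in N) = false by rewrite inE (negPf vR).
have NE x : x \in R -> (x \in N) = (adj s x v == 1) by move=> xR; rewrite inE xR.
have vw : (v == w) = false by rewrite eq_sym (negPf wv).
have neqw x : x \in R -> (x == w) = false by move=> xR; apply: contraNF wR => /eqP <-.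
have neqv x : x \in R -> (x == v) = false by move=> xR; apply: contraNF vR => /eqP <-.
have sN := sk.1; have s0 := skew_xx sk.
move=> i j; rewrite -sgn_fun_arc sgn_fun_switch -/s.
have sRR x y : x \in R -> y \in R -> s x y = 0.
  by move=> xR yR; apply/(adj_eq0 sk)/R0.
have ssw x : x \in R -> s w x * s w x = 1.
  by move=> xR; rewrite -expr2; apply: aR.
have sxv x : x \in R -> s w x * eps * s x v = adj s x v.
  move=> xR; case: (adj01 sk x v) => e; rewrite e.
    by rewrite (adj_eq0 sk e) mulr0.
  by rewrite -mulrA [eps * _]mulrC mulrA (prod x xR e) -expr2 e2.
case: (cases i) => [->|->|iR]; case: (cases j) => [->|->|jR];
  rewrite ?sw ?sv ?(sR i) ?(sR j) // ?eqxx ?Nw ?Nv ?(negPf wR) ?(negPf vR)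
    ?(negPf wv) ?vw ?neqw ?neqv ?iR ?jR ?andbF ?orbF ?andbT //=.
- by rewrite s0 mulr0.
- by rewrite swv mul1r mulrCA -expr2 e2 mulr1; case: (b).
- by rewrite mul1r ssw.
- by rewrite mulr1 (sN v w) swv mulrN mulrCA -expr2 e2 mulr1; case: (b).
- by rewrite s0 mulr0.
- rewrite (sN v j) mulrN [eps * _]mulrC sxv //.
  by case: (adj01 sk j v) => ->.
- by rewrite mulr1 (sN i w) mulrN ssw.
- by rewrite sxv // NE.
- by rewrite (sRR i j) // mulr0.
Qed.

(** Coherence provides eps. If the arc between the hubs has the opposite sign, passing to the
    converse repairs this: it negates that arc but keeps products of two entries. *)
Lemma skew_isomorphic_model K (b : bool) G H w v R :
  H =2 @hub_arc n K b -> (2 < n)%N -> (K <= n - 2)%N ->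
  two_hubs (sgn_fun G) w v R -> w |: (v |: R) = setT ->
  deg (sgn_fun G) R v = K%:Z -> coherent (sgn_fun G) w v R ->
  adj (sgn_fun G) w v = b%:Z -> skew_isomorphic G H.
Proof.
set s := sgn_fun G; move=> HE gn Kn hubs eT dK coh awv.
have [wv wR vR aR R0] := hubs; have sk : skew_fun s := sgn_fun_skew G.
have [eps [e2 prod]] : exists eps : int, eps ^+ 2 = 1 /\
    {in R, forall x, adj s x v = 1 -> s w x * s x v = eps}.
  have [/exists_inP [y yR /eqP ay]|h] := boolP [exists y in R, adj s y v == 1].
    exists (s w y * s y v); split; last by move=> x xR ax; apply: coh.
    by rewrite exprMn -!/(adj s _ _) aR // ay.
  (* No vertex of R sees v, so any sign will do and 1 is a default. *)
  exists 1; rewrite expr1n; split=> // x xR ax.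
  by have := exists_inPn h x xR; rewrite ax.
have eps1 : eps = 1 \/ eps = -1.
  by have := mulf_eq0 (eps - 1) (eps + 1); rewrite -subr_sqr_1 e2 subrr eqxx; lia.
have [e|e] : s w v = b%:Z * eps \/ s w v = - (b%:Z * eps).
  move: awv; case: (adjP sk w v) => _; case: (b) => // _;
    by case: eps1 => ->; auto.
  by have [W iso] := switch_model HE gn Kn hubs eT dK e2 prod e; exists W; left.
have [|||W iso] := switch_model HE gn Kn (two_hubs_converse hubs) eT _ e2 _.
- rewrite -dK; apply: eq_bigr => x _; exact: adj_converse.
- by move=> x xR; rewrite adj_converse !sgn_fun_converse mulrNN; apply: prod.
- by rewrite sgn_fun_converse -/s e opprK.
by exists W; right.
Qed.

End Switching.

(* 2 * m + 5 < 3 * n is m < (3n - 5)/2. *)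
Theorem theorem1p1 (C : numClosedFieldType) (n m : nat)
    (hnm : n <= m < 2 * (n - 2))
    (G : orgraph n) (hG : min_skew_energy C m G) :
  [/\ 2 * m + 5 < 3 * n -> skew_isomorphic G (Oplus n m),
      2 * m + 5 = 3 * n ->
        skew_isomorphic G (Bplus n m) \/ skew_isomorphic G (Oplus n m)
    & 3 * n < 2 * m + 5 -> skew_isomorphic G (Bplus n m)].
Proof.
have /andP [nm mn] := hnm; have gn : 2 < n by lia.
have [cG aG minG] := hG.
(* Comparing energies with a model having the same n and m bounds a_4 of [G] from above. *)
have bound K b (H : orgraph n) : H =2 @hub_arc n K b -> K <= n - 2 -> b || (0 < K) ->
    n - 2 + K + b = m -> (pf_sum4 (sgn_fun G) setT <= hub_bound n%:Z K%:Z)%R.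
  move=> HE Kn bK em; have aH := model_num_arcs HE gn Kn.
  rewrite -(model_pf_sum4 HE gn Kn); apply: energy_pf_sum4.
  - by rewrite !dbl_edges_num_arcs aG aH em.
  - exact: (model_rank HE gn Kn C).
  - by apply: minG; [apply: (model_connected HE gn Kn bK) | rewrite aH].
have KO : m - n + 1 <= n - 2 by lia.
have KB : m - n + 2 <= n - 2 by lia.
have hO := @Oplus_hub n m; have hB := @Bplus_hub n m nm.
have bO := bound _ _ _ hO; have bB := bound _ _ _ hB.
have {}bO : (pf_sum4 (sgn_fun G) setT <= hub_bound n%:Z (m - n + 1)%N%:Z)%R by apply: bO; lia.
have {}bB : (pf_sum4 (sgn_fun G) setT <= hub_bound n%:Z (m - n + 2)%N%:Z)%R by apply: bB; lia.
have E2G : (dbl_edges (sgn_fun G) setT = 2 * m%:Z)%R by rewrite dbl_edges_num_arcs aG.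
have eK : (m%:Z - n%:Z + 1 = (m - n + 1)%N%:Z)%R by lia.
have eK' : (m%:Z - n%:Z + 1 + 1 = (m - n + 2)%N%:Z)%R by lia.
(* With k = m - n + 1, the hypothesis [m < 2 * (n - 2)] is k <= n - 4, and [n <= m] is k >= 1. *)
have := extremal_two_hubs (sgn_fun_skew G) (connected_conn cG) E2G; cbv zeta.
rewrite cardsT card_ord eK' eK => -[||//|//|w [v [R [eT hubs coh hK]]]]; try lia.
have lb := two_hubs_lb (sgn_fun_skew G) hubs; rewrite -eT cardsT card_ord in lb.
(* Since f(k + 1) - f(k) = 3 n - 5 - 2 m, a graph of one type lying below the bound of the other
   excludes the range where that other bound is strictly smaller. *)
case: hK => -[awv dv].
  have iO : skew_isomorphic G (Oplus n m).
    exact: skew_isomorphic_model hO gn KO hubs (esym eT) dv coh awv.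
  rewrite dv in lb; have := Order.POrderTheory.le_trans lb bB; rewrite /hub_bound => h.
  by split=> // h'; [right | exfalso; nia].
have iB : skew_isomorphic G (Bplus n m).
  exact: skew_isomorphic_model hB gn KB hubs (esym eT) dv coh awv.
rewrite dv in lb; have := Order.POrderTheory.le_trans lb bO; rewrite /hub_bound => h.
by split=> // h'; [exfalso; nia | left].
Qed.
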